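(* If a graph $G$ has an embedding in $\mathbb{R}^3$ that simultaneously realizes $mnl_n(G)$ for all $n$, then $\overline{mnl}(\overline{DG})\leq\sum_n mnl_n(G)\cdot 2^n$.
   Context: Graphs are finite and embeddings are (tame) embeddings in $\mathbb{R}^3$; $n\ge 2$ denotes a number of link components. For an undirected graph $G$, $\overline{DG}$ is the symmetric digraph formed by replacing each edge $v_1v_2$ of $G$ with the two directed edges $v_1v_2$ and $v_2v_1$. A cycle in a digraph is consistently oriented if it is a directed cycle (a pair of oppositely directed edges $uv$, $vu$ is a consistently oriented 2-cycle). An $n$-component link in an embedding of a graph is given by a set of $n$ pairwise disjoint cycles of the graph; it is consistently oriented (in a digraph) if all of these cycles are consistently oriented. Links are distinct if they are given by different sets of cycles. A link is non-split if no embedded 2-sphere in its complement separates some of its components from the others. $mnl_n(G)$ is the minimum over all embeddings of $G$ of the number of distinct non-split $n$-component links; an embedding realizes $mnl_n(G)$ if it contains exactly $mnl_n(G)$ such links. For a digraph $\overline{G}$, $\overline{mnl}(\overline{G})$ is the minimum over all embeddings of $\overline{G}$ of the number of distinct consistently oriented non-split links (of any number of components). *)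

(* Defs.v *)
From HB Require Import structures.
From mathcomp Require Import all_boot all_order all_algebra.
From mathcomp Require Import all_classical all_reals all_analysis.
Import Order.TTheory GRing.Theory Num.Theory.
Import numFieldNormedType.Exports.

Set Implicit Arguments.
Unset Strict Implicit.
Unset Printing Implicit Defensive.

Local Open Scope classical_set_scope.
Local Open Scope ring_scope.

(* The library has no graph theory suitable for spatial graphs.  Graphs here
   are finite multigraphs, because the symmetric digraph of even a simple graph
   has two edges between adjacent vertices.  The ends of an edge of an
   undirected graph are listed in an arbitrary order; only the parametrization
   of the edge in an embedding refers to this order. *)
Record graph := Graph {
  vertex : finType;
  edge : finType;
  ends : edge -> vertex * vertex }.

Record digraph := Digraph {
  dvertex : finType;
  darc : finType;
  src : darc -> dvertex;
  tgt : darc -> dvertex }.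

Definition underlying (D : digraph) : graph :=
  @Graph (dvertex D) (darc D) (fun a => (src a, tgt a)).

(* (e, false) is e traversed from its first to its second end, (e, true) is e
   traversed backwards. *)
Definition dart_src (G : graph) (d : edge G * bool) : vertex G :=
  if d.2 then (ends d.1).2 else (ends d.1).1.
Definition dart_tgt (G : graph) (d : edge G * bool) : vertex G :=
  if d.2 then (ends d.1).1 else (ends d.1).2.

Definition symmetric_digraph (G : graph) : digraph :=
  @Digraph (vertex G) (edge G * bool)%type (@dart_src G) (@dart_tgt G).

(* A cycle is identified with its edge set; it is traversed by a closed walk
   [s] without repeated edge or vertex.  Distinctness of the edges only
   excludes going back and forth along a single edge. *)
Definition is_cycle (G : graph) (C : {set edge G}) : Prop :=
  exists s : seq (edge G * bool),
    [/\ s != [::],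
        path.cycle (fun d d' => dart_tgt d == dart_src d') s,
        uniq (map (@dart_src G) s),
        uniq (map fst s) &
        C = [set e in map fst s]%SET].

Definition consistently_oriented (D : digraph) (C : {set darc D}) : Prop :=
  exists s : seq (darc D),
    [/\ s != [::],
        path.cycle (fun a b => tgt a == src b) s,
        uniq (map (@src D) s) &
        C = [set a in s]%SET].

Definition vertices_of (G : graph) (C : {set edge G}) : {set vertex G} :=
  [set v | [exists e in C, (v == (ends e).1) || (v == (ends e).2)]]%SET.

Definition is_link (G : graph) (L : {set {set edge G}}) : Prop :=
  (forall C, C \in L -> is_cycle C) /\
  (forall C C', C \in L -> C' \in L -> C != C' ->
     (vertices_of C :&: vertices_of C' = finset.set0)%SET).

Definition homeomorphism (T : topologicalType) (h : T -> T) : Prop :=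
  continuous h /\
  exists k : T -> T, [/\ continuous k, cancel h k & cancel k h].

Section Embeddings.
Variable R : realType.

Local Notation R3 := 'rV[R]_3.

Definition line_segment (a b : R3) : set R3 :=
  [set (1 - t) *: a + t *: b | t in `[0, 1]%classic].

(* [g] runs, on [0, 1], through finitely many straight segments in turn; its
   speed along each of them is not required to be constant. *)
Definition polygonal (g : R -> R3) : Prop :=
  exists (N : nat) (t : nat -> R),
    [/\ t 0%N = 0, t N = 1 &
        forall i, (i < N)%N -> t i < t i.+1 /\
          g @` `[t i, t i.+1] = line_segment (g (t i)) (g (t i.+1))].

(* The conditions before [curve_tame] say that [point] and [curve] glue to a
   continuous injection of the geometric realization of G; by compactness this
   is a topological embedding.  Tame means ambient homeomorphic to a polygonal
   embedding. *)
Record embedding (G : graph) := Embedding {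
  position : vertex G -> R3;
  curve : edge G -> R -> R3;
  position_inj : injective position;
  curve_cont : forall e, {within `[0, 1], continuous (curve e)};
  curve0 : forall e, curve e 0 = position (ends e).1;
  curve1 : forall e, curve e 1 = position (ends e).2;
  curve_position : forall e v t, 0 < t < 1 -> curve e t <> position v;
  curve_inj : forall e e' t t', 0 < t < 1 -> 0 < t' < 1 ->
    curve e t = curve e' t' -> e = e' /\ t = t';
  curve_tame : exists h : R3 -> R3,
    homeomorphism h /\ forall e, polygonal (h \o curve e) }.

Definition image_of (G : graph) (f : embedding G) (C : {set edge G}) :
    set R3 :=
  [set x | exists e t, [/\ e \in C, 0 <= t <= 1 & x = curve f e t]].

Definition unit_sphere : set R3 := [set x | \sum_i x 0 i ^+ 2 = 1].

Definition embedded_sphere (S : set R3) : Prop :=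
  exists phi : R3 -> R3,
    [/\ {within unit_sphere, continuous phi},
        set_inj unit_sphere phi &
        S = phi @` unit_sphere].

Definition split_by (G : graph) (f : embedding G) (L : {set {set edge G}})
    (S : set R3) : Prop :=
  (forall C, C \in L -> S `&` image_of f C = set0) /\
  exists A : {set {set edge G}},
    [/\ A != finset.set0, A \proper L &
        forall C C' x y, C \in A -> C' \in (L :\: A)%SET ->
          image_of f C x -> image_of f C' y ->
          ~ connected_component (~` S) x y].

Definition non_split (G : graph) (f : embedding G) (L : {set {set edge G}}) :
    Prop :=
  ~ exists S, embedded_sphere S /\ split_by f L S.

Definition num_links (G : graph) (f : embedding G) (n : nat) : nat :=
  #|[set L : {set {set edge G}} |
      `[< [/\ #|L| = n, is_link L & non_split f L] >]]%SET|.

(* A link has at least two components; knots are not counted. *)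
Definition num_oriented_links (D : digraph) (f : embedding (underlying D)) :
    nat :=
  #|[set L : {set {set darc D}} |
      `[< [/\ (2 <= #|L|)%N, is_link (G := underlying D) L, non_split f L &
              forall C, C \in L -> consistently_oriented C] >]]%SET|.

(* The default 0 is returned only for the empty set; every finite graph has an
   embedding, so it plays no role in the definitions below. *)
Definition minimum (A : set nat) : nat :=
  xget 0%N [set k | A k /\ forall m, A m -> (k <= m)%N].

Definition mnl (G : graph) (n : nat) : nat :=
  minimum (range (fun f : embedding G => num_links f n)).

Definition mnl_oriented (D : digraph) : nat :=
  minimum (range (@num_oriented_links D)).

Definition realizes_mnl (G : graph) (f : embedding G) (n : nat) : Prop :=
  num_links f n = mnl G n.

End Embeddings.

(* Main.v *)
Require Import Defs.
From mathcomp Require Import all_boot all_order all_algebra.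
From mathcomp Require Import all_classical all_reals all_analysis.
From mathcomp Require Import lra ring.
Import Order.TTheory GRing.Theory Num.Theory.
Import numFieldNormedType.Exports.

Set Implicit Arguments.
Unset Strict Implicit.
Unset Printing Implicit Defensive.

(** Let f be an embedding of G that realizes every mnl_n.  An embedding g of the
    symmetric digraph is obtained by keeping the edge curves of f for the
    forward arcs and by running each backward arc in a small neighbourhood of
    the curve of its edge.  It suffices that every consistently oriented
    non-split n-component link of g lies over a non-split n-component link of
    f, and that at most 2^n of them lie over the same one: summing over the
    links of f then gives the bound.

    Neighbourhoods are measured by finitely many test spheres.  For every split
    link of f, fix a sphere that splits it; for every edge e that is not a loop,
    fix a sphere that separates e from all edges having no vertex in common
    with e ([edge_sphere]).  The backward arc over e is required to miss each
    of those spheres that the curve of e misses ([doubled_embedding]).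

    Let L be a consistently oriented non-split link of g.  If a component of L
    used both arcs over an edge e, it would be the 2-cycle formed by them, and
    the sphere around e would split it off ([double_edge_split]).  So each
    component of L projects to a cycle of G.  If the projected link were split
    in f, its chosen sphere would miss the backward arcs of L too, and these are
    connected to the forward arcs at their ends, so that the sphere would split
    L ([split_by_forget]).  Finally a cycle of G has at most two consistent
    orientations, and one is determined by the direction of a single edge, which
    gives the factor 2^n ([card_lifts]).

    Two constructions in space carry this.  Tameness makes the embedding
    polygonal after a homeomorphism, and then a polygonal arc inside a given
    open set, avoiding finitely many segments, is built by general position:
    each new vertex is chosen off finitely many planes ([arc_avoiding]).  For the
    sphere around e, the polygonal arc is shortened segment by segment by
    homeomorphisms that fix the rest of the picture ([push], [arc_contracts]);
    once the arc lies in a small ball, the preimage of the boundary of the ball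
    is the desired sphere. *)

(** * Directed cycles *)

Section OrientedCycles.
Variable D : digraph.
Implicit Types (C : {set darc D}) (a b : darc D).

Lemma oriented_neq0 C : consistently_oriented C -> C != finset.set0.
Proof.
case=> -[|a s] [] // _ _ _ ->; apply/set0Pn; exists a.
by rewrite inE mem_head.
Qed.

Lemma oriented_src_inj C : consistently_oriented C -> {in C &, injective (@src D)}.
Proof.
case=> s [_ _ us ->] a b; rewrite !inE => sa sb eab.
have := uniqP (src a) us; move/(_ (index a s) (index b s)).
rewrite !inE !size_map !index_mem !(nth_map a) ?index_mem// !nth_index//.
by move=> /(_ sa sb eab) ei; rewrite -(nth_index a sa) ei nth_index.
Qed.

(** The head of each arc is the tail of the next one, so the heads are the tails
    rotated by one place.  In particular heads are distinct as well. *)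
Lemma cycle_map_tgt (s : seq (darc D)) :
  path.cycle (fun a b => tgt a == src b) s ->
  map (@tgt D) s = rot 1 (map (@src D) s).
Proof.
case: s => //= x p; rewrite rot1_cons -map_rcons => cp.
have key y q : path (fun a b => tgt a == src b) y q ->
    map (@tgt D) (belast y q) = map (@src D) q.
  by elim: q y => //= z q IH y /andP[/eqP -> /IH ->].
by have := key _ _ cp; rewrite belast_rcons.
Qed.

Lemma oriented_tgt_inj C : consistently_oriented C -> {in C &, injective (@tgt D)}.
Proof.
case=> s [_ cs us ->] a b; rewrite !inE => sa sb eab.
have ut : uniq (map (@tgt D) s) by rewrite cycle_map_tgt// rot_uniq.
have := uniqP (tgt a) ut; move/(_ (index a s) (index b s)).
rewrite !inE !size_map !index_mem !(nth_map a) ?index_mem// !nth_index//.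
by move=> /(_ sa sb eab) ei; rewrite -(nth_index a sa) ei nth_index.
Qed.

(** A directed cycle is traversed by successors starting from any of its arcs,
    so a property passed on to successors holds for all arcs. *)
Lemma oriented_ind C (P : darc D -> Prop) a :
  consistently_oriented C -> a \in C -> P a ->
  (forall x y, x \in C -> y \in C -> P x -> tgt x = src y -> P y) ->
  forall x, x \in C -> P x.
Proof.
case=> s [_ cs _ ->]; rewrite inE => sa Pa step.
case: (rot_to sa) => i p ip.
have cp : path (fun a b => tgt a == src b) a p.
  have : path.cycle (fun a b => tgt a == src b) (a :: p) by rewrite -ip rot_cycle.
  by rewrite /= rcons_path => /andP[].
have eqs x : (x \in s) = (x \in a :: p) by rewrite -ip mem_rot.
have {}step x y : x \in a :: p -> y \in a :: p -> P x -> tgt x = src y -> P y.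
  by rewrite -!eqs => xs ys; apply: step; rewrite inE.
move=> x; rewrite inE eqs.
elim: p a Pa {ip eqs sa} cp step x => [|b p IH] a Pa /=.
  by move=> _ _ x; rewrite inE => /eqP ->.
case/andP=> /eqP tab bp step x.
have Pb : P b by apply: (step a b); rewrite ?inE ?eqxx ?orbT.
rewrite inE => /predU1P[-> //|xp]; apply: (IH b) => // y z yp zp.
by apply: step; rewrite inE ?yp ?zp orbT.
Qed.

End OrientedCycles.

(** * Projecting oriented links to the undirected graph *)

Section Projection.
Variable G : graph.
Local Notation DG := (symmetric_digraph G).
Local Notation UG := (underlying DG).
Implicit Types (C : {set darc DG}) (L : {set {set darc DG}}).

Definition forget C : {set edge G} := (fst @: C)%SET.

Lemma mem_forget C (d : darc DG) : d \in C -> d.1 \in forget C.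
Proof. by move=> dC; apply/imsetP; exists d. Qed.

(** The projection of a directed cycle is a cycle of the graph exactly when it
    does not contain an edge in both directions. *)
Definition simple C :=
  forall e, ~ (((e, false) : darc DG) \in C /\ ((e, true) : darc DG) \in C).

Lemma simple_eq C (d d' : darc DG) : simple C -> d \in C -> d' \in C ->
  d.1 = d'.1 -> d = d'.
Proof.
move=> sC; case: d d' => [e b] [e' b'] /= dC d'C ee'; subst e'.
by case: b b' dC d'C => [] [] // h h'; case: (sC e).
Qed.

Lemma vertices_of_forget C :
  vertices_of (G := UG) C = vertices_of (forget C).
Proof.
apply/setP => v; rewrite !inE; apply/existsP/existsP.
  case=> -[e b] /andP[eC h]; exists e; rewrite (mem_forget eC) /=.
  by move: h; rewrite /= /dart_src /dart_tgt; case: b {eC} => //=; rewrite orbC.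
case=> e /andP[/imsetP[[e' b] eC /= ->]] h; exists (e', b); rewrite eC /=.
by move: h; rewrite /= /dart_src /dart_tgt; case: b {eC} => //=; rewrite orbC.
Qed.

Lemma forget_cycle C : simple C -> consistently_oriented C -> is_cycle (forget C).
Proof.
move=> sC [s [s0 cs us eC]]; exists s; split => //.
  rewrite map_inj_in_uniq; first exact: map_uniq us.
  by move=> x y xs ys; apply: (@simple_eq C) => //; rewrite eC inE.
apply/setP => e; rewrite inE; apply/imsetP/mapP => -[d ds ->]; exists d => //.
  by move: ds; rewrite eC inE.
by rewrite eC inE.
Qed.

(** After (e, false) the cycle reaches the tail of (e, true), so it returns along
    e.  A loop is excluded because its two directions have the same tail. *)
Lemma oriented_double C e : consistently_oriented C ->
  ((e, false) : darc DG) \in C -> ((e, true) : darc DG) \in C ->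
  (ends e).1 <> (ends e).2 /\
  C = [set ((e, false) : darc DG); ((e, true) : darc DG)]%SET.
Proof.
move=> oC fC tC; split.
  move=> eE; have := oriented_src_inj oC fC tC.
  by rewrite /= /dart_src /= eE => /(_ erefl).
apply/setP => d; apply/idP/idP; last by rewrite !inE => /orP[]/eqP ->.
move: d; apply: (oriented_ind oC fC); first by rewrite !inE eqxx.
move=> x y xC yC; rewrite !inE => /orP[]/eqP -> txy; apply/orP.
  by right; apply/eqP; apply: (oriented_src_inj oC) => //; rewrite -txy.
by left; apply/eqP; apply: (oriented_src_inj oC) => //; rewrite -txy.
Qed.

(** Two orientations of a cycle that agree on one edge agree on the next one:
    the reverse of the next arc has the same head as the current arc, hence it
    cannot belong to the second orientation. *)
Lemma oriented_lift_eq C C' d : simple C -> simple C' ->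
  consistently_oriented C -> consistently_oriented C' ->
  forget C = forget C' -> d \in C -> d \in C' -> C = C'.
Proof.
have sub (B B' : {set darc DG}) : simple B -> 
    consistently_oriented B -> consistently_oriented B' ->
    forget B = forget B' -> d \in B -> d \in B' -> {subset B <= B'}.
  move=> sB oB oB' eB dB dB'; apply: (oriented_ind oB dB dB').
  move=> x y xB yB xB' txy.
  have /imsetP[[e b] zB' /= ye] : y.1 \in forget B' by rewrite -eB mem_forget.
  case: y ye yB txy => [e' b'] /= -> yB txy.
  have [<-//|bb'] := eqVneq b b'.
  have xz : x = (e, b).
    apply: (oriented_tgt_inj oB') => //=; rewrite [LHS]txy /=.
    by rewrite /dart_src /dart_tgt /=; case: b b' bb' {zB' yB txy} => [] [].
  by case/negP: bb'; have := simple_eq sB xB yB; rewrite xz => /(_ erefl) [->].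
move=> sC sC' oC oC' eC dC dC'; apply/setP => x; apply/idP/idP; exact: sub.
Qed.

End Projection.

Section ProjectionOfLinks.
Variable G : graph.
Local Notation DG := (symmetric_digraph G).
Local Notation UG := (underlying DG).
Implicit Types (C : {set darc DG}) (L : {set {set darc DG}}).

Definition forget_link L : {set {set edge G}} := (@forget G @: L)%SET.

(** The conditions under which forgetting the directions gives a link of the
    graph with as many components. *)
Definition liftable L :=
  is_link (G := UG) L /\
  forall C, C \in L -> consistently_oriented C /\ simple C.

Lemma mem_vertices_of (H : graph) (C : {set edge H}) (e : edge H) :
  e \in C -> (ends e).1 \in vertices_of C.
Proof. by move=> eC; rewrite inE; apply/existsP; exists e; rewrite eC eqxx. Qed.

Lemma link_vertex_eq (H : graph) (L : {set {set edge H}}) (C C' : {set edge H}) v :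
  is_link L ->
  C \in L -> C' \in L -> v \in vertices_of C -> v \in vertices_of C' -> C = C'.
Proof.
move=> [_ dL] CL C'L vC vC'; apply/eqP/negPn/negP => CC'.
by have /setP/(_ v) := dL _ _ CL C'L CC'; rewrite !inE in vC vC' *; rewrite vC vC'.
Qed.

Lemma forget_inj L : liftable L -> {in L &, injective (@forget G)}.
Proof.
move=> [lL oL] C C' CL C'L fCC'.
have /set0Pn[d dC] := oriented_neq0 (oL _ CL).1.
have vC := mem_vertices_of (H := UG) dC.
by apply: (link_vertex_eq lL CL C'L vC); rewrite vertices_of_forget -fCC' -vertices_of_forget.
Qed.

Lemma card_forget_link L : liftable L -> #|forget_link L| = #|L|.
Proof. by move=> lL; apply: card_in_imset; apply: forget_inj. Qed.

Lemma forget_is_link L : liftable L -> is_link (forget_link L).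
Proof.
move=> [lL oL]; split=> [_ /imsetP[C CL ->]|].
  by have [oC sC] := oL _ CL; apply: forget_cycle.
move=> _ _ /imsetP[C CL ->] /imsetP[C' C'L ->] CC'.
rewrite -!vertices_of_forget; apply: lL.2 => //.
by apply: contraNneq CC' => ->.
Qed.

(** The direction in which L traverses a base edge chosen in C, the one returned
    by [pick]; it determines the orientation of the component over C. *)
Definition reversed_base L (C : {set edge G}) : bool :=
  if [pick e in C] is Some e then ((e, true) : darc DG) \in finset.cover L
  else false.

Lemma reversed_baseE L C e b : liftable L -> C \in L ->
  [pick x in forget C] = Some e -> ((e, b) : darc DG) \in C ->
  reversed_base L (forget C) = b.
Proof.
move=> [lL oL] CL pe eC; rewrite /reversed_base pe.
case: b eC => eC; first by apply/bigcupP; exists C.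
apply/negbTE/negP => /bigcupP[C' C'L eC'].
have CC' : C = C'.
  have vC : (ends e).1 \in vertices_of (G := UG) C.
    by rewrite vertices_of_forget; exact: (mem_vertices_of (mem_forget eC)).
  apply: (link_vertex_eq lL CL C'L vC); rewrite vertices_of_forget.
  exact: (mem_vertices_of (mem_forget eC')).
by have [_ /(_ e)[]] := oL _ CL; split=> //; rewrite CC'.
Qed.

(** A lift of M is determined by the set of components whose base edge is
    reversed, which is a subset of M. *)
Lemma card_lifts (Q : {set {set {set darc DG}}}) (M : {set {set edge G}}) :
  (forall L, L \in Q -> liftable L /\ forget_link L = M) -> (#|Q| <= 2 ^ #|M|)%N.
Proof.
move=> QM; pose f L := [set C in M | reversed_base L C]%SET.
have sub L L' : L \in Q -> L' \in Q -> f L = f L' -> {subset L <= L'}.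
  move=> /QM[lL LM] /QM[lL' LM'] ff C CL.
  have CM : forget C \in M by rewrite -LM; apply/imsetP; exists C.
  have /imsetP[C' C'L' fCC'] : forget C \in forget_link L' by rewrite LM'.
  have [oC sC] := lL.2 _ CL; have [oC' sC'] := lL'.2 _ C'L'.
  have /set0Pn[d dC] := oriented_neq0 oC.
  have : exists e, [pick x in forget C] = Some e.
    by case: pickP => [e _|/(_ d.1)]; [exists e | rewrite /= mem_forget].
  case=> e pe; have eC : e \in forget C by move: pe; case: pickP => // ? ? [<-].
  have [[e1 b] bC /= e1E] := imsetP eC; subst e1.
  move: (eC); rewrite fCC' => /imsetP[[e1 b'] bC' /= e1E]; subst e1.
  have bE := reversed_baseE lL CL pe bC.
  have bE' : reversed_base L' (forget C') = b'.
    by apply: (reversed_baseE lL' C'L' _ bC'); rewrite -fCC'.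
  have bb' : b = b'.
    by move/setP/(_ (forget C)): ff; rewrite !inE CM /= bE fCC' bE'.
  rewrite -bb' in bC'; by rewrite (oriented_lift_eq sC sC' oC oC' fCC' bC bC').
have fI : {in Q &, injective f}.
  by move=> L L' LQ L'Q ff; apply/setP => C; apply/idP/idP; apply: sub.
rewrite -(card_in_imset fI) -card_powerset; apply: subset_leq_card.
apply/fintype.subsetP => _ /imsetP[L _ ->]; rewrite powersetE.
by apply/fintype.subsetP => C; rewrite inE => /andP[].
Qed.

End ProjectionOfLinks.

(** * General position in space *)

Local Open Scope classical_set_scope.
Local Open Scope ring_scope.

Section GeneralPosition.
Variable R : realType.
Local Notation R3 := 'rV[R]_3.
Implicit Types (a b c u v w x y z n : R3) (X : seq (R3 * R3)).

Definition dot n y : R := \sum_i n 0 i * y 0 i.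

Lemma dotD n x y : dot n (x + y) = dot n x + dot n y.
Proof. by rewrite -big_split; apply: eq_bigr => i _; rewrite mxE mulrDr. Qed.

Lemma dotZ n (k : R) x : dot n (k *: x) = k * dot n x.
Proof. by rewrite big_distrr; apply: eq_bigr => i _; rewrite mxE mulrCA. Qed.

Lemma dotxx n : (dot n n == 0) = (n == 0).
Proof.
apply/eqP/eqP => [|->]; last first.
  by rewrite /dot big1 // => i _; rewrite mxE mul0r.
move=> n0; apply/rowP => i; rewrite mxE.
apply/eqP; rewrite -sqrf_eq0; apply/eqP.
apply: (psumr_eq0P (P := predT) (F := fun j => n 0 j ^+ 2)) => //.
by move=> j _; exact: sqr_ge0.
Qed.

Lemma dot_continuous n : continuous (dot n).
Proof.
apply: continuous_big => [|i _ x]; first exact: add_continuous.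
apply: (@continuousM R R3 (cst (n 0 i)) (fun y : R3 => y 0 i)).
  exact: cst_continuous.
exact: coord_continuous.
Qed.

(** Two linear equations in three unknowns have a nonzero solution.  This is
    where the dimension of the space enters. *)
Lemma common_normal u v : exists n, [/\ n != 0, dot n u = 0 & dot n v = 0].
Proof.
pose A : 'M[R]_(3, 1 + 1) := row_mx u^T v^T.
have kA : kermx A != 0.
  rewrite -mxrank_eq0 mxrank_ker subn_eq0 -ltnNge.
  exact: leq_ltn_trans (rank_leq_col A) _.
pose n := nz_row (kermx A); exists n.
have nA : n *m A = 0 by apply/sub_kermxP; exact: nz_row_sub.
rewrite mul_mx_row -row_mx0 in nA; have [nu nv] := eq_row_mx nA.
have dotE w : dot n w = (n *m w^T) 0 0.
  by rewrite mxE; apply: eq_bigr => i _; rewrite mxE.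
by rewrite !dotE nu nv !mxE nz_row_eq0; split.
Qed.

(** A pair (a, n) stands for the plane through a with normal n. *)
Definition off_planes (s : seq (R3 * R3)) : set R3 :=
  [set y | forall h, h \in s -> dot h.2 (y - h.1) != 0].

Lemma open_off_plane a n : open [set y | dot n (y - a) != 0].
Proof.
rewrite (_ : [set y | _] = (fun y => dot n (y - a)) @^-1` (~` [set 0])).
  apply: open_comp; last by apply: closed_openC; exact: closed_eq.
  move=> y _; apply: continuous_comp; last exact: dot_continuous.
  by apply: (@continuousB R R3 R3 id (cst a)) => //; exact: cst_continuous.
by apply/seteqP; split => y /= /eqP.
Qed.

Lemma dense_off_plane a n : n != 0 -> dense [set y | dot n (y - a) != 0].
Proof.
move=> n0 O [c Oc] oO.
have [h0|h0] := eqVneq (dot n (c - a)) 0; last by exists c.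
have /nbhs_ballP[e /= e0 eO] := open_nbhs_nbhs (conj oO Oc).
have nn : 0 < `|n| by rewrite normr_gt0.
have k0 : 0 < e / (2 * `|n|) by rewrite divr_gt0 // mulr_gt0.
exists (c + (e / (2 * `|n|)) *: n); split.
  apply: eO; rewrite -ball_normE /= opprD addrA subrr sub0r normrN normrZ.
  rewrite gtr0_norm // (_ : e / (2 * `|n|) * `|n| = e / 2); last by field; rewrite gt_eqF.
  by rewrite ltr_pdivrMr// ltr_pMr// ltr1n.
by rewrite /= addrAC dotD h0 add0r dotZ mulf_neq0 ?dotxx// gt_eqF.
Qed.

Lemma open_dense_off_planes s : (forall h, h \in s -> h.2 != 0) ->
  open (off_planes s) /\ dense (off_planes s).
Proof.
elim: s => [|h s IH] s0.
  rewrite (_ : off_planes [::] = setT); last by apply/seteqP; split.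
  by split; [exact: openT | move=> O [x Ox] _; exists x].
have [|oP dP] := IH; first by move=> k ks; apply: s0; rewrite inE ks orbT.
rewrite (_ : off_planes _ = [set y | dot h.2 (y - h.1) != 0] `&` off_planes s).
  split; first by apply: openI => //; exact: open_off_plane.
  apply: denseI => //; first exact: open_off_plane.
  by apply: dense_off_plane; apply: s0; rewrite mem_head.
apply/seteqP; split => y /=.
  by move=> hy; split=> [|k ks]; apply: hy; rewrite inE ?eqxx ?ks ?orbT.
by move=> [hy sy] k; rewrite inE => /predU1P[->|/sy].
Qed.

Definition segments X : set R3 :=
  [set x | exists2 h, h \in X & line_segment h.1 h.2 x].

Lemma segments_cat X Y x : segments (X ++ Y) x <-> segments X x \/ segments Y x.
Proof.
split=> [[h]|]; first by rewrite mem_cat => /orP[] ? ?; [left|right]; exists h.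
by move=> [] [h hX hx]; exists h; rewrite ?mem_cat ?hX ?orbT.
Qed.

Lemma line_segment_start a b : line_segment a b a.
Proof.
exists 0 => /=; last by rewrite subr0 scale1r scale0r addr0.
by rewrite in_itv /= lexx ler01.
Qed.

(** Stated for the whole ray from a through y, because the points y to be excluded
    then form a cone with apex a. *)
Definition avoids_from a X y := forall s : R, 0 < s -> ~ segments X (a + s *: (y - a)).

(** The cone with apex a over a segment lies in a plane through a. *)
Lemma avoid_segment a h : exists n, n != 0 /\
  forall y, dot n (y - a) != 0 -> avoids_from a [:: h] y.
Proof.
have [n [n0 nu nv]] := common_normal (h.1 - a) (h.2 - a).
exists n; split=> // y ny s s0 [_ /[!inE] /eqP -> [t _ e]].
have : dot n (s *: (y - a)) = 0.
  rewrite (_ : s *: _ = (1 - t) *: (h.1 - a) + t *: (h.2 - a)).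
    by rewrite dotD !dotZ nu nv !mulr0 addr0.
  rewrite !scalerBr addrACA e -opprD -scalerDl subrK scale1r.
  by rewrite -scalerBr addrAC subrr add0r.
by rewrite dotZ => /eqP; rewrite mulf_eq0 gt_eqF//= (negbTE ny).
Qed.

Lemma avoid_segments a X : exists s, (forall h, h \in s -> h.2 != 0) /\
  forall y, off_planes s y -> avoids_from a X y.
Proof.
elim: X => [|h X [s [s0 sX]]]; first by exists [::]; split => // y _ k _ [].
have [n [n0 nh]] := avoid_segment a h; exists ((a, n) :: s); split.
  by move=> k; rewrite inE => /predU1P[->//|/s0].
move=> y sy k k0 /(segments_cat [:: h] X)[].
  by apply: nh => //; exact: (sy (a, n) (mem_head _ _)).
by apply: sX => // g gs; apply: sy; rewrite inE gs orbT.
Qed.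

Lemma generic_point X a c (e : R) : 0 < e ->
  exists y, ball c e y /\ avoids_from a X y.
Proof.
move=> e0; have [s [s0 sX]] := avoid_segments a X.
have [_ /(_ (ball c e))] := open_dense_off_planes s0.
case=> [||y [cy sy]]; [by exists c; exact: ballxx | exact: ball_open | ].
by exists y; split => //; exact: sX.
Qed.

(** To join a to b through a vertex y near c, two segments avoiding X are needed
    that meet only at y.  A plane containing the line ab serves for the last
    condition: off it, a, b and y are not collinear. *)
Lemma generic_corner X a b c (e : R) : 0 < e -> a <> b ->
  exists y, [/\ ball c e y, avoids_from a X y, avoids_from b X y &
    forall s t : R, 0 < s <= 1 -> 0 < t <= 1 ->
      a + s *: (y - a) = b + t *: (y - b) -> s = 1 /\ t = 1].
Proof.
move=> e0 ab; have [s [s0 sX]] := avoid_segments a X.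
have [s' [s'0 s'X]] := avoid_segments b X.
have [n [n0 nab _]] := common_normal (a - b) 0.
have [|_ /(_ (ball c e))] := @open_dense_off_planes ((b, n) :: s ++ s').
  by move=> h; rewrite inE mem_cat => /predU1P[->//|/orP[/s0|/s'0]].
case=> [||y [cy sy]]; [by exists c; exact: ballxx | exact: ball_open | ].
exists y; split => //.
- by apply: sX => h hs; apply: sy; rewrite inE mem_cat hs orbT.
- by apply: s'X => h hs; apply: sy; rewrite inE mem_cat hs !orbT.
move=> k t _ _ kt.
have kt' : (1 - k) *: (a - b) + k *: (y - b) = t *: (y - b).
  rewrite -[t *: _](addrK b) [_ + b]addrC -kt.
  by apply/rowP => i; rewrite !mxE; ring.
have ny := sy (b, n) (mem_head _ _); rewrite /= in ny.
have kE : k = t.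
  move: (congr1 (dot n) kt'); rewrite dotD !dotZ nab mulr0 add0r.
  by apply: mulIf.
move: kt'; rewrite -kE => /eqP; rewrite -subr_eq0 addrK scaler_eq0.
rewrite [a - b == 0]subr_eq0 (negbTE (introN eqP ab)) orbF subr_eq0 => /eqP k1.
by rewrite -k1.
Qed.

End GeneralPosition.

(** * Polygonal arcs with a new vertex at every integer time *)

Section PolygonalPaths.
Variable R : realType.
Local Notation R3 := 'rV[R]_3.
Implicit Types (X : seq (R3 * R3)) (gamma : R -> R3) (y p q : R3).

Definition clamp (s : R) : R := Num.max 0 (Num.min s 1).

Lemma clamp_continuous : continuous clamp.
Proof.
move=> s; apply: (@continuous_max R R (cst 0) (id \min cst 1)).
  exact: cst_continuous.
by apply: continuous_min; [exact: cvg_id|exact: cst_continuous].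
Qed.

Lemma clamp_le0 s : s <= 0 -> clamp s = 0.
Proof. by move=> s0; rewrite /clamp min_l ?max_l// (le_trans s0). Qed.

Lemma clamp_id s : 0 <= s <= 1 -> clamp s = s.
Proof. by move=> /andP[s0 s1]; rewrite /clamp min_l// max_r. Qed.

Lemma clamp_ge1 s : 1 <= s -> clamp s = 1.
Proof. by move=> s1; rewrite /clamp min_r// max_r. Qed.

(** The n segments of the path are run at the times [0, 1], ..., [n - 1, n]; the
    path rests at its end afterwards, so that [extend] may add a segment by a
    formula that is continuous everywhere. *)
Definition polyline (n : nat) gamma : Prop :=
  [/\ continuous gamma,
      forall s, n%:R <= s -> gamma s = gamma n%:R &
      forall i s, (i < n)%N -> i%:R <= s <= i.+1%:R ->
        gamma s = gamma i%:R + (s - i%:R) *: (gamma i.+1%:R - gamma i%:R)].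

Definition extend (n : nat) gamma y : R -> R3 :=
  fun s => gamma s + clamp (s - n%:R) *: (y - gamma n%:R).

Lemma extend_old n gamma y s : s <= n%:R -> extend n gamma y s = gamma s.
Proof.
by move=> sn; rewrite /extend clamp_le0 ?subr_le0// scale0r addr0.
Qed.

Lemma extend_new n gamma y s : polyline n gamma -> n%:R <= s <= n.+1%:R ->
  extend n gamma y s = gamma n%:R + (s - n%:R) *: (y - gamma n%:R).
Proof.
move=> [_ cg _] /andP[ns sn]; rewrite /extend cg// clamp_id//.
by rewrite subr_ge0 ns lerBlDr nat1r.
Qed.

Lemma extend_end n gamma y s : polyline n gamma -> n.+1%:R <= s ->
  extend n gamma y s = y.
Proof.
move=> [_ cg _] sn; rewrite /extend cg; last first.
  by apply: le_trans sn; rewrite ler_nat.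
by rewrite clamp_ge1 ?lerBrDr ?nat1r// scale1r addrC subrK.
Qed.

Lemma extend_polyline n gamma y :
  polyline n gamma -> polyline n.+1 (extend n gamma y).
Proof.
move=> pg; have [ctg cg lg] := pg; split.
- move=> s; apply: (@continuousD R R3 R gamma (fun s => clamp (s - n%:R) *: (y - gamma n%:R))).
    exact: ctg.
  apply: (@continuousZ R R3 R (fun s => clamp (s - n%:R)) (cst (y - gamma n%:R))); last exact: cst_continuous.
  apply: (@continuous_comp _ _ _ (fun s : R => s - n%:R) clamp); last exact: clamp_continuous.
  by apply: (@continuousB R R R id (cst n%:R)) => //; exact: cst_continuous.
- by move=> s ns; rewrite !extend_end.
move=> i s; rewrite ltnS leq_eqVlt => /predU1P[->|lin] hs.
  by rewrite extend_new// extend_old// extend_end.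
have h (k : nat) : (k <= n)%N -> extend n gamma y k%:R = gamma k%:R.
  by move=> kn; rewrite extend_old// ler_nat.
rewrite !h ?(ltnW lin)// -lg// extend_old//.
by have /andP[_ /le_trans ->] := hs; rewrite // ler_nat.
Qed.

(** The constant segment at gamma 0 covers the start of a path with n = 0. *)
Definition edges_of (n : nat) gamma : seq (R3 * R3) :=
  (gamma 0, gamma 0) :: [seq (gamma i%:R, gamma i.+1%:R) | i <- iota 0 n].

Lemma breakpoint_interval (t : nat -> R) n s : t 0%N <= s <= t n ->
  s = t 0%N \/ exists2 i, (i < n)%N & t i <= s <= t i.+1.
Proof.
elim: n => [|n IH] /andP[s0 sn]; first by left; apply/eqP; rewrite eq_le s0 sn.
have [sn'|ns] := leP s (t n); last by right; exists n; rewrite // (ltW ns).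
have [||[i lin hs]] := IH; first by rewrite s0.
  by left.
by right; exists i; rewrite // ltnS ltnW.
Qed.

Lemma polyline_edges n gamma s : polyline n gamma -> 0 <= s <= n%:R ->
  segments (edges_of n gamma) (gamma s).
Proof.
move=> [_ _ lg] /(@breakpoint_interval (fun i => i%:R))[->|[i lin hs]].
  by exists (gamma 0, gamma 0); [rewrite mem_head | exact: line_segment_start].
exists (gamma i%:R, gamma i.+1%:R).
  by rewrite inE; apply/orP; right; apply/mapP; exists i; rewrite // mem_iota.
exists (s - i%:R) => /=.
  by have /andP[? ?] := hs; rewrite in_itv /= subr_ge0 lerBlDr nat1r; apply/andP.
rewrite (lg i s lin hs) scalerBl scale1r scalerBr.
by rewrite addrA addrAC.
Qed.

Lemma polyline_polygonal n gamma : (0 < n)%N -> polyline n gamma ->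
  polygonal (fun s => gamma (s * n%:R)).
Proof.
move=> n0 [_ _ lg]; have nR : 0 < n%:R :> R by rewrite ltr0n.
exists n, (fun i => i%:R / n%:R); split; first by rewrite mul0r.
  by rewrite divff// gt_eqF.
move=> i lin; split; first by rewrite ltr_pM2r ?invr_gt0// ltr_nat.
rewrite !divfK ?gt_eqF//; apply/seteqP; split.
  move=> _ [s hs <-]; move: hs; rewrite /= in_itv /= ler_pdivrMr// ler_pdivlMr//.
  move=> /andP[i_s s_i].
  exists (s * n%:R - i%:R) => /=.
    by rewrite in_itv /= subr_ge0 i_s lerBlDr nat1r.
  rewrite (lg i (s * n%:R)) ?i_s//.
  by rewrite scalerBl scale1r scalerBr addrA addrAC.
move=> _ [t ht <-]; move: ht; rewrite /= in_itv /= => /andP[t0 t1].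
exists ((i%:R + t) / n%:R) => /=.
  by rewrite in_itv /= !ler_pM2r ?invr_gt0// lerDl t0 -natr1 lerD2l.
rewrite divfK ?gt_eqF// (lg i) ?lerDl ?t0 -?natr1 ?lerD2l//.
by rewrite addrAC subrr add0r scalerBl scale1r scalerBr addrA addrAC.
Qed.

End PolygonalPaths.

(** * Arcs in an open set avoiding finitely many segments *)

Section ParallelArc.
Variable R : realType.
Local Notation R3 := 'rV[R]_3.
Variables (X : seq (R3 * R3)) (U : set R3) (p : R3).
Hypothesis oU : open U.
Implicit Types (gamma : R -> R3) (y z : R3).

Lemma ball_segment (c a b : R3) (r t : R) :
  ball c r a -> ball c r b -> 0 <= t <= 1 -> ball c r (a + t *: (b - a)).
Proof.
rewrite -!ball_normE /= => ca cb /andP[t0 t1].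
have -> : c - (a + t *: (b - a)) = (1 - t) *: (c - a) + t *: (c - b).
  by apply/rowP => i; rewrite !mxE; ring.
apply: (le_lt_trans (ler_normD _ _)); rewrite !normrZ ger0_norm ?subr_ge0//.
rewrite (ger0_norm t0).
have [->|t1'] := eqVneq t 1; first by rewrite subrr mul0r add0r mul1r.
rewrite (_ : r = (1 - t) * r + t * r); last by ring.
apply: ltr_leD; last by rewrite ler_wpM2l// ltW.
by rewrite ltr_pM2l// subr_gt0 lt_neqAle t1'.
Qed.

Definition arc_from (n : nat) gamma : Prop :=
  [/\ polyline n gamma, gamma 0 = p,
      forall s t, 0 <= s <= n%:R -> 0 <= t <= n%:R -> gamma s = gamma t -> s = t,
      forall s, 0 < s <= n%:R -> ~ segments X (gamma s) &
      forall s, 0 <= s <= n%:R -> U (gamma s)].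

Lemma arc_from0 : U p -> arc_from 0 (cst p).
Proof.
move=> Up; split => //.
- by split=> //; exact: cst_continuous.
- move=> s t /andP[s0 s1] /andP[t0 t1] _.
  have -> : s = 0 by apply/eqP; rewrite eq_le s0 s1.
  by apply/eqP; rewrite eq_le t0 t1.
- by move=> s /andP[/lt_le_trans /[apply]]; rewrite ltxx.
Qed.

Lemma arc_from_extend n gamma y : arc_from n gamma ->
  (forall t, 0 <= t <= 1 -> U (gamma n%:R + t *: (y - gamma n%:R))) ->
  avoids_from (gamma n%:R) (X ++ edges_of n gamma) y ->
  arc_from n.+1 (extend n gamma y).
Proof.
move=> [pg g0 ig Xg Ug] Uy Xy.
have yn : y - gamma n%:R != 0.
  rewrite subr_eq0; apply/eqP => yg; apply: (Xy 1 ltr01).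
  rewrite yg subrr scaler0 addr0; apply/segments_cat; right.
  by apply: polyline_edges => //; rewrite ler0n lexx.
have new (s : R) : s <= n.+1%:R -> n%:R <= s -> 0 <= s - n%:R <= 1.
  by move=> sn ns; rewrite subr_ge0 ns lerBlDr nat1r.
have newX (s : R) : n%:R < s -> s <= n.+1%:R ->
    ~ segments (X ++ edges_of n gamma) (extend n gamma y s).
  move=> ns sn; rewrite extend_new ?(ltW ns)//; apply: Xy.
  by rewrite subr_gt0.
have old (s : R) : 0 <= s <= n%:R ->
    segments (X ++ edges_of n gamma) (extend n gamma y s).
  move=> hs; have /andP[_ sn] := hs; rewrite extend_old//.
  by apply/segments_cat; right; exact: polyline_edges.
split; first exact: extend_polyline.
- by rewrite extend_old.
- move=> s t /andP[s0 s1] /andP[t0 t1].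
  have [sn|ns] := leP s n%:R; have [tn|nt] := leP t n%:R.
  + by rewrite !extend_old//; apply: ig; apply/andP.
  + by move=> st; case: (newX t nt t1); rewrite -st; apply: old; rewrite s0.
  + by move=> st; case: (newX s ns s1); rewrite st; apply: old; rewrite t0.
  + rewrite !extend_new ?(ltW ns) ?(ltW nt)// => /addrI /eqP.
    rewrite -subr_eq0 -scalerBl scaler_eq0 (negbTE yn) orbF subr_eq0.
    by move=> /eqP /addIr.
- move=> s /andP[s0 s1]; have [sn|ns] := leP s n%:R.
    by rewrite extend_old//; apply: Xg; rewrite s0.
  by move=> Xs; apply: (newX s ns s1); apply/segments_cat; left.
- move=> s /andP[s0 s1]; have [sn|ns] := leP s n%:R.
    by rewrite extend_old//; apply: Ug; rewrite s0.
  by rewrite extend_new ?(ltW ns)//; apply: Uy; apply: new => //; exact: ltW.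
Qed.

(** Only approximate ends are asked for, because y itself may lie on X.  The
    condition 0 < n ensures that the end of the arc is off X. *)
Definition reachable y : Prop := forall e : R, 0 < e ->
  exists n gamma, [/\ (0 < n)%N, arc_from n gamma & ball y e (gamma n%:R)].

Lemma arc_from_ball c r y n gamma : ball c r `<=` U -> ball c r y ->
  arc_from n gamma -> ball c r (gamma n%:R) ->
  forall e : R, 0 < e ->
  exists m gamma', [/\ (0 < m)%N, arc_from m gamma' & ball y e (gamma' m%:R)].
Proof.
move=> cU cy ag gc e e0.
have : nbhs y (ball c r `&` ball y e).
  by apply: filterI; [apply: open_nbhs_nbhs; split => //; exact: ball_open |
                      exact: nbhsx_ballx].
move=> /nbhs_ballP[d /= d0 dsub].
have [w [yw Xw]] := generic_point (X ++ edges_of n gamma) (gamma n%:R) y d0.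
have [cw ew] := dsub _ yw.
exists n.+1, (extend n gamma w); split => //.
  apply: arc_from_extend => // t ht; apply: cU; exact: ball_segment.
by rewrite extend_end//; case: ag.
Qed.

Lemma reachable_ball c r y z : ball c r `<=` U -> ball c r y -> ball c r z ->
  reachable y -> reachable z.
Proof.
move=> cU cy cz ry.
have /nbhs_ballP[d /= d0 dc] : nbhs y (ball c r).
  by apply: open_nbhs_nbhs; split => //; exact: ball_open.
have [n [gamma [_ ag yg]]] := ry _ d0.
by apply: (arc_from_ball cU cz ag); exact: dc.
Qed.

(** By [reachable_ball], reachability is constant on balls inside U, so the
    reachable points of E form a subset of E that is open and closed. *)
Lemma reachable_connected (E : set R3) : connected E -> E `<=` U -> E p ->
  forall y, E y -> reachable y.
Proof.
move=> cE EU Ep.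
have loc y : U y -> exists2 r : R, 0 < r & ball y r `<=` U.
  move=> Uy; have /nbhs_ballP[r r0 rU] := open_nbhs_nbhs (conj oU Uy).
  by exists r.
have rp : reachable p.
  have [r r0 rU] := loc _ (EU _ Ep).
  apply: (arc_from_ball rU _ (arc_from0 (EU _ Ep))) => //; exact: ballxx.
suff <- : E `&` reachable = E by move=> y [].
apply: cE; first by exists p.
  exists (U `&` reachable); last by rewrite setIA (setIidl EU).
  rewrite openE => y [Uy ry]; have [r r0 rU] := loc _ Uy.
  apply/nbhs_ballP; exists r => //= z yz; split; first exact: rU.
  by apply: reachable_ball rU _ yz ry; exact: ballxx.
exists (~` (U `&` ~` reachable)).
  apply: open_closedC; rewrite openE => y [Uy ry]; have [r r0 rU] := loc _ Uy.
  apply/nbhs_ballP; exists r => //= z yz; split; first exact: rU.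
  by move=> rz; apply: ry; apply: reachable_ball rU yz _ rz; exact: ballxx.
apply/seteqP; split=> y [Ey h]; split => //; first by case.
by apply: contrapT => nr; apply: h; split => //; exact: EU.
Qed.

(** The arc stops at a generic point close to q and reaches q through one more
    generic vertex w.  A single segment from the point already reached to q would
    leave nothing to perturb. *)
Lemma arc_avoiding (E : set R3) q : connected E -> E `<=` U -> E p -> E q ->
  segments X q ->
  exists c : R -> R3, [/\ continuous c, polygonal c, c 0 = p, c 1 = q &
    [/\ forall t t', 0 < t < 1 -> 0 < t' < 1 -> c t = c t' -> t = t',
        forall t, 0 < t < 1 -> ~ segments X (c t) &
        forall t, 0 <= t <= 1 -> U (c t)]].
Proof.
move=> cE EU Ep Eq Xq.
have /nbhs_ballP[r /= r0 rU] := open_nbhs_nbhs (conj oU (EU _ Eq)).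
have [n [gamma [n0 ag qg]]] := reachable_connected cE EU Ep Eq r0.
have [pg g0 ig Xg Ug] := ag.
have gq : gamma n%:R <> q.
  by move=> gq; apply: (Xg n%:R); rewrite ?gq// ltr0n n0 lexx.
have [w [qw Xw Xw' ww]] := generic_corner (X ++ edges_of n gamma) q r0 gq.
have ag1 : arc_from n.+1 (extend n gamma w).
  by apply: arc_from_extend => // t ht; apply: rU; exact: ball_segment.
set g1 := extend n gamma w in ag1.
have [pg1 g10 ig1 Xg1 Ug1] := ag1.
have g1w : g1 n.+1%:R = w by rewrite /g1 extend_end.
pose g2 := extend n.+1 g1 q.
have pg2 : polyline n.+2 g2 by exact: extend_polyline.
have newE (s : R) : n.+1%:R <= s <= n.+2%:R ->
    g2 s = q + (n.+2%:R - s) *: (w - q).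
  move=> hs; rewrite /g2 extend_new// g1w -(natr1 n.+1).
  by apply/rowP => i; rewrite !mxE; ring.
have key (s t : R) : 0 < s <= n.+1%:R -> n.+1%:R < t < n.+2%:R -> g2 s <> g2 t.
  move=> /andP[s0 s1] /andP[t0 t1].
  rewrite (newE t) ?(ltW t0) ?(ltW t1)// /g2 extend_old//.
  have t2 : 0 < n.+2%:R - t by rewrite subr_gt0.
  have [sn|ns] := leP s n%:R => st.
    apply: (Xw' _ t2); rewrite -st /g1 extend_old//; apply/segments_cat; right.
    by apply: polyline_edges; rewrite // (ltW s0).
  move: st; rewrite /g1 extend_new ?(ltW ns)// => /ww[].
  - by rewrite subr_gt0 ns lerBlDr nat1r.
  - by rewrite t2 lerBlDr -natr1 addrC lerD2l ltW.
  - move=> _ /eqP; rewrite subr_eq addrC -subr_eq -natr1 addrK => /eqP tE.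
    by move: t0; rewrite tE ltxx.
have N0 : 0 < n.+2%:R :> R by rewrite ltr0n.
exists (fun t => g2 (t * n.+2%:R)); split.
- move=> t; apply: (@continuous_comp _ _ _ (fun t : R => t * n.+2%:R) g2).
    by apply: (@continuousM R R id (cst n.+2%:R)) => //; exact: cst_continuous.
  by case: pg2 => + _ _; apply.
- exact: polyline_polygonal.
- by rewrite mul0r /g2 extend_old.
- by rewrite mul1r /g2 extend_end.
have scale (t : R) : 0 < t < 1 -> 0 < t * n.+2%:R < n.+2%:R.
  by move=> /andP[t0 t1]; rewrite mulr_gt0//= gtr_pMl.
split.
- move=> t t' /scale ht /scale ht' gt.
  apply: (@mulIf _ n.+2%:R); first by rewrite gt_eqF.
  move: (t * n.+2%:R) (t' * n.+2%:R) ht ht' gt => {}t {}t'.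
  move=> /andP[t0 t1] /andP[t'0 t'1] gt.
  have [tn|nt] := leP t n.+1%:R; have [tn'|nt'] := leP t' n.+1%:R.
  + by move: gt; rewrite /g2 !extend_old//; apply: ig1; rewrite ltW.
  + by case: (@key t t'); rewrite ?t0 ?nt'.
  + by case: (@key t' t); rewrite ?t'0 ?nt.
  + move: gt; rewrite !newE ?(ltW nt) ?(ltW nt') ?ltW// => /addrI/eqP.
    rewrite -subr_eq0 -scalerBl scaler_eq0 subr_eq0 => /orP[/eqP|].
      by move=> /addrI/oppr_inj.
    rewrite subr_eq0 => /eqP wq; case: (Xw' 1 ltr01).
    by rewrite wq subrr scaler0 addr0; apply/segments_cat; left.
- move=> t /scale; move: (t * n.+2%:R) => {}t /andP[t0 t1].
  have [tn|nt] := leP t n.+1%:R.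
    by rewrite /g2 extend_old//; apply: Xg1; rewrite t0.
  rewrite newE ?(ltW nt) ?ltW// => Xt; apply: (Xw' (n.+2%:R - t)).
    by rewrite subr_gt0.
  by apply/segments_cat; left.
- move=> t /andP[t0 t1].
  have : 0 <= t * n.+2%:R <= n.+2%:R.
    by rewrite mulr_ge0//= ger_pMl.
  move: (t * n.+2%:R) => {t0 t1}t /andP[t0 t1].
  have [tn|nt] := leP t n.+1%:R.
    by rewrite /g2 extend_old//; apply: Ug1; rewrite t0.
  rewrite newE ?(ltW nt) ?t1//; apply: rU; apply: ball_segment => //.
    exact: ballxx.
  by rewrite subr_ge0 t1 lerBlDr -natr1 addrC lerD2l ltW.
Qed.

End ParallelArc.

(** * Doubling the edges of an embedding *)

Section Doubling.
Variable R : realType.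
Local Notation R3 := 'rV[R]_3.

Lemma polygonal_segments (g : R -> R3) : polygonal g ->
  exists Y, forall t, 0 <= t <= 1 -> segments Y (g t).
Proof.
move=> [N [t [t0 tN tg]]]; exists [seq (g (t i), g (t i.+1)) | i <- iota 0 N].
move=> s hs; have [i lin his] : exists2 i, (i < N)%N & t i <= s <= t i.+1.
  have [||//] := @breakpoint_interval R t N s; first by rewrite t0 tN.
  move=> ->; case: N tN tg {hs} => [|N] tN tg.
    by move: tN; rewrite t0 => /eqP; rewrite eq_sym oner_eq0.
  by exists 0%N => //; rewrite lexx ltW//; case: (tg 0%N isT).
exists (g (t i), g (t i.+1)); first by apply/mapP; exists i; rewrite // mem_iota.
by have [_ <-] := tg i lin; exists s => //; rewrite /= in_itv.
Qed.

Lemma polygonal_segments_seq (I : eqType) (c : I -> R -> R3) (s : seq I) :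
  (forall e, e \in s -> polygonal (c e)) ->
  exists Y, forall e t, e \in s -> 0 <= t <= 1 -> segments Y (c e t).
Proof.
elim: s => [|e s IH] ps; first by exists [::].
have [|Y hY] := IH; first by move=> x xs; apply: ps; rewrite inE xs orbT.
have [Y' hY'] := polygonal_segments (ps e (mem_head _ _)).
exists (Y' ++ Y) => x t; rewrite inE => /predU1P[->|xs] ht.
  by apply/segments_cat; left; exact: hY'.
by apply/segments_cat; right; exact: hY.
Qed.

(** The arcs are constructed one after the other; X is enlarged by the segments
    of the arcs already present. *)
Lemma disjoint_arcs (I : eqType) (X : seq (R3 * R3)) (p q : I -> R3)
    (U E : I -> set R3) (s : seq I) :
  (forall e, [/\ open (U e), connected (E e), E e `<=` U e, E e (p e) & E e (q e)]) ->
  (forall e, segments X (q e)) ->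
  exists c : I -> R -> R3,
    (forall e, e \in s ->
      [/\ continuous (c e), polygonal (c e), c e 0 = p e, c e 1 = q e &
      (forall t, 0 < t < 1 -> ~ segments X (c e t)) /\
      (forall t, 0 <= t <= 1 -> U e (c e t))]) /\
    (forall e e' t t', e \in s -> e' \in s -> 0 < t < 1 -> 0 < t' < 1 ->
      c e t = c e' t' -> e = e' /\ t = t').
Proof.
move=> UE Xq; elim: s => [|e s [c [cs cI]]]; first by exists (fun _ _ => 0).
have [es|es] := boolP (e \in s).
  exists c; split=> [x|x x' t t']; first by rewrite inE => /predU1P[->|]; apply: cs.
  rewrite !inE => hx hx'; apply: cI.
    by case/predU1P: hx => [->|].
  by case/predU1P: hx' => [->|].
have [Y hY] : exists Y, forall e t, e \in s -> 0 <= t <= 1 -> segments Y (c e t).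
  by apply: polygonal_segments_seq => x /cs[].
have [oU cE EU Ep Eq] := UE e.
have [|d [cd pd d0 d1 [dI dX dU]]] := arc_avoiding (X := X ++ Y) oU cE EU Ep Eq.
  by apply/segments_cat; left.
exists (fun x => if x == e then d else c x); split.
  move=> x; rewrite inE; case: eqP => [-> _|_ /=]; last exact: cs.
  by split=> //; split=> // t /dX dt Xt; apply: dt; apply/segments_cat; left.
have dc x t t' : x \in s -> 0 < t < 1 -> 0 < t' < 1 -> d t <> c x t'.
  move=> xs ht /andP[/ltW t0 /ltW t1] dct; apply: (dX t ht).
  by rewrite dct; apply/segments_cat; right; apply: hY => //; rewrite t0.
move=> x x' t t'; rewrite !inE; case: (eqVneq x e) => [->|_ /=]; case: (eqVneq x' e) => [->|_ /=].
- by move=> _ _ ht ht' /dI; split => //; auto.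
- by move=> _ xs ht ht' /dc; case.
- by move=> xs _ ht ht' /esym/dc; case.
- exact: cI.
Qed.

(** The backward arcs are built in the polygonal picture h o f and transported
    back by the inverse k of h, so the same h witnesses tameness.  The open set
    for the arc over e is the complement of the sets Z i that e misses; the
    curve of e lies in it and connects its ends. *)
Lemma doubled_embedding (G : graph) (f : embedding R G) (I : finType)
    (Z : I -> set R3) : (forall i, closed (Z i)) ->
  exists g : embedding R (underlying (symmetric_digraph G)),
    (forall e, curve g (e, false) = curve f e) /\
    (forall e i, (forall t, 0 <= t <= 1 -> ~ Z i (curve f e t)) ->
       forall t, 0 <= t <= 1 -> ~ Z i (curve g (e, true) t)).
Proof.
move=> cZ; have [h [[ch [k [ck hK kK]]] hpoly]] := curve_tame f.
have hI : injective h := can_inj hK.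
have kI : injective k := can_inj kK.
have [Y hY] : exists Y, forall e t, e \in enum (edge G) -> 0 <= t <= 1 ->
    segments Y (h (curve f e t)).
  by apply: (@polygonal_segments_seq _ (fun e => h \o curve f e)) => e _; exact: hpoly.
pose X := Y ++ [seq (h (position f v), h (position f v)) | v <- enum (vertex G)].
have Xv v : segments X (h (position f v)).
  apply/segments_cat; right; exists (h (position f v), h (position f v)).
    by apply/mapP; exists v; rewrite // mem_enum.
  exact: line_segment_start.
have Xe e t : 0 <= t <= 1 -> segments X (h (curve f e t)).
  by move=> ht; apply/segments_cat; left; apply: hY; rewrite ?mem_enum.
pose avoided e := [set i | forall t, 0 <= t <= 1 -> ~ Z i (curve f e t)].
pose U e := k @^-1` (~` \bigcup_(i in avoided e) Z i).
pose E e := (h \o curve f e) @` `[0, 1].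
pose p e := h (position f (ends e).2).
pose q e := h (position f (ends e).1).
have UE e : [/\ open (U e), connected (E e), E e `<=` U e, E e (p e) & E e (q e)].
  split.
  - apply: open_comp => [x _|]; first exact: ck.
    by apply: closed_openC; apply: closed_bigcup => // ; exact: finite_finset.
  - apply: connected_continuous_connected; first exact: segment_connected.
    by apply: within_continuous_comp; [move=> x _; exact: ch | exact: curve_cont].
  - move=> _ [t ht <-] [i ai]; rewrite /= hK; apply: ai.
    by move: ht; rewrite /= in_itv.
  - by exists 1; rewrite /= ?in_itv/= ?ler01 ?lexx ?curve1.
  - by exists 0; rewrite /= ?in_itv/= ?ler01 ?lexx ?curve0.
have Xq e : segments X (q e) by exact: Xv.
have [c [cs cI]] := disjoint_arcs (enum (edge G)) UE Xq.
have {}cs e : [/\ continuous (c e), polygonal (c e), c e 0 = p e, c e 1 = q e &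
      (forall t, 0 < t < 1 -> ~ segments X (c e t)) /\
      (forall t, 0 <= t <= 1 -> U e (c e t))] by apply: cs; rewrite mem_enum.
have {}cI e e' t t' : 0 < t < 1 -> 0 < t' < 1 -> c e t = c e' t' -> e = e' /\ t = t'.
  by apply: cI; rewrite mem_enum.
pose crv (d : edge G * bool) : R -> R3 := if d.2 then k \o c d.1 else curve f d.1.
have ww (t : R) : 0 < t < 1 -> 0 <= t <= 1 by move=> /andP[/ltW -> /ltW ->].
have cc e : {within `[0, 1], continuous (k \o c e)}.
  apply: continuous_subspaceT => t; have [+ _ _ _ _] := cs e.
  by move=> /(_ t) ct; apply: continuous_comp; [exact: ct | exact: ck].
have pI : injective (position f) := @position_inj _ _ f.
have mixed e e' t t' : 0 < t < 1 -> 0 < t' < 1 -> curve f e t <> k (c e' t').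
  move=> ht ht' eq; have [_ _ _ _ [cX _]] := cs e'; apply: (cX t' ht').
  by rewrite -[c _ _]kK -eq; apply: Xe; exact: ww.
pose UG := underlying (symmetric_digraph G).
have crv_cont (d : edge UG) : {within `[0, 1], continuous (crv d)}.
  by case: d => e [] /=; [exact: cc | exact: curve_cont].
have crv0 (d : edge UG) : crv d 0 = position f (ends d).1.
  case: d => e [] /=; last exact: curve0.
  by have [_ _ c0 _ _] := cs e; rewrite /crv /= c0 hK.
have crv1 (d : edge UG) : crv d 1 = position f (ends d).2.
  case: d => e [] /=; last exact: curve1.
  by have [_ _ _ c1 _] := cs e; rewrite /crv /= c1 hK.
have crv_pos (d : edge UG) v t : 0 < t < 1 -> crv d t <> position f v.
  case: d => e [] /=; last exact: curve_position.
  move=> ht /(congr1 h); rewrite /crv /= kK => eq.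
  by have [_ _ _ _ [cX _]] := cs e; apply: (cX t ht); rewrite eq; exact: Xv.
have crv_inj (d d' : edge UG) t t' : 0 < t < 1 -> 0 < t' < 1 ->
    crv d t = crv d' t' -> d = d' /\ t = t'.
  case: d d' => e [] [e' []] ht ht'; rewrite /crv /=.
  - by move=> /kI /cI[]// -> ->.
  - by move=> /esym/mixed; case.
  - by move=> /mixed; case.
  - by move=> /curve_inj[]// -> ->.
have crv_tame : exists h : R3 -> R3,
    homeomorphism h /\ forall d : edge UG, polygonal (h \o crv d).
  exists h; split; first by split => //; exists k.
  case=> e [] /=; last exact: hpoly.
  have [_ pc _ _ _] := cs e; rewrite (_ : h \o _ = c e)//.
  by apply/funext => t; rewrite /crv /= kK.
exists (@Embedding R UG (position f) crv pI crv_cont crv0 crv1 crv_pos crv_inj crv_tame).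
split=> // e i ai t ht /= Zt; have [_ _ _ _ [_ /(_ t ht)]] := cs e.
by apply; exists i.
Qed.

End Doubling.

(** * Pushing along a segment *)

Section Push.
Variable R : realType.
Local Notation R3 := 'rV[R]_3.

Lemma homeomorphism_comp (T : topologicalType) (h h' : T -> T) :
  homeomorphism h -> homeomorphism h' -> homeomorphism (h \o h').
Proof.
move=> [ch [k [ck hk kh]]] [ch' [k' [ck' hk' kh']]]; split.
  by move=> x; apply: continuous_comp; [exact: ch' | exact: ch].
exists (k' \o k); split; [|exact: can_comp|exact: can_comp].
by move=> x; apply: continuous_comp; [exact: ck | exact: ck'].
Qed.

(** With increasing bijections of the line, t |-> min(t, max(A t, B t)) is again
    one, and its inverse is obtained by inverting the three functions and
    exchanging min and max. *)
Lemma min_maxK (A A' B B' : R -> R) :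
  {homo A' : x y / x <= y} -> {homo B' : x y / x <= y} ->
  cancel A A' -> cancel B B' ->
  cancel (fun t => Num.min t (Num.max (A t) (B t)))
         (fun y => Num.max y (Num.min (A' y) (B' y))).
Proof.
move=> mA mB AK BK t /=; have [tM|Mt] := leP t (Num.max (A t) (B t)).
  rewrite max_l// ge_min; move: tM; rewrite le_max => /orP[/mA|/mB].
    by rewrite AK => ->.
  by rewrite BK => ->; rewrite orbT.
have [AB|BA] := leP (A t) (B t).
  move: Mt; rewrite max_r// => Bt.
  have := mA _ _ AB; rewrite AK BK => h; rewrite min_r// max_r//; exact: ltW.
move: Mt; rewrite max_l ?(ltW BA)// => At.
have := mB _ _ (ltW BA); rewrite AK BK => h; rewrite min_l// max_r//; exact: ltW.
Qed.

Lemma max_minK (A A' B B' : R -> R) :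
  {homo A : x y / x <= y} -> {homo B : x y / x <= y} ->
  cancel A' A -> cancel B' B ->
  cancel (fun y => Num.max y (Num.min (A' y) (B' y)))
         (fun t => Num.min t (Num.max (A t) (B t))).
Proof.
move=> mA mB AK BK y /=; have [yM|My] := leP (Num.min (A' y) (B' y)) y.
  rewrite min_l// le_max; move: yM; rewrite ge_min => /orP[/mA|/mB].
    by rewrite AK => ->.
  by rewrite BK => ->; rewrite orbT.
have [AB|BA] := leP (A' y) (B' y).
  move: My; rewrite min_l// => Ay.
  have := mB _ _ AB; rewrite AK BK => h; rewrite max_l// min_r//; exact: ltW.
move: My; rewrite min_r ?(ltW BA)// => By.
have := mA _ _ (ltW BA); rewrite AK BK => h; rewrite max_r// min_r//; exact: ltW.
Qed.

Definition rescale (o k : R) (t : R) : R := o + k * (t - o).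

Lemma rescaleK o k k' : k' * k = 1 -> cancel (rescale o k) (rescale o k').
Proof.
move=> kk t; rewrite /rescale addrAC subrr add0r mulrA kk mul1r.
by rewrite addrC subrK.
Qed.

Lemma rescale_le o k : 0 <= k -> {homo rescale o k : x y / x <= y}.
Proof. by move=> k0 x y xy; rewrite lerD2l ler_wpM2l// lerB. Qed.

Section Squeeze.
Variables (l r : R).
Hypotheses (l1 : l < 1) (r1 : 1 < r).

(** For l < m <= 1 < r, the piecewise linear homeomorphism of the line that fixes
    everything outside the interval from l to r and sends 1 to m.  As m <= 1, the
    map from [l, 1] to [l, m] has slope at most 1 and that from [1, r] to [m, r]
    slope at least 1, which is why min and max express it without cases. *)
Definition squeeze (m t : R) : R :=
  Num.min t (Num.max (rescale l ((m - l) / (1 - l)) t)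
                     (rescale r ((r - m) / (r - 1)) t)).
Definition unsqueeze (m t : R) : R :=
  Num.max t (Num.min (rescale l ((1 - l) / (m - l)) t)
                     (rescale r ((r - 1) / (r - m)) t)).

Variable m : R.
Hypotheses (lm : l < m) (m1 : m <= 1).

Let l1' : 0 < 1 - l. Proof. by rewrite subr_gt0. Qed.
Let r1' : 0 < r - 1. Proof. by rewrite subr_gt0. Qed.
Let lm' : 0 < m - l. Proof. by rewrite subr_gt0. Qed.
Let rm' : 0 < r - m. Proof. by rewrite subr_gt0 (le_lt_trans m1). Qed.

Lemma squeezeK : cancel (squeeze m) (unsqueeze m).
Proof.
apply: min_maxK.
- by apply: rescale_le; rewrite divr_ge0// ltW.
- by apply: rescale_le; rewrite divr_ge0// ltW.
- by apply: rescaleK; field; rewrite !gt_eqF.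
- by apply: rescaleK; field; rewrite !gt_eqF.
Qed.

Lemma unsqueezeK : cancel (unsqueeze m) (squeeze m).
Proof.
apply: max_minK.
- by apply: rescale_le; rewrite divr_ge0// ltW.
- by apply: rescale_le; rewrite divr_ge0// ltW.
- by apply: rescaleK; field; rewrite !gt_eqF.
- by apply: rescaleK; field; rewrite !gt_eqF.
Qed.

Lemma squeeze_left t : t <= l -> squeeze m t = t.
Proof.
move=> tl; rewrite /squeeze min_l// le_max /rescale; apply/orP; left.
have k1 : (m - l) / (1 - l) <= 1 by rewrite ler_pdivrMr// mul1r lerD2r.
have : (1 - (m - l) / (1 - l)) * (t - l) <= 0.
  by rewrite mulr_ge0_le0 ?subr_ge0 ?subr_le0.
by rewrite mulrBl mul1r; lra.
Qed.

Lemma squeeze_right t : r <= t -> squeeze m t = t.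
Proof.
move=> rt; rewrite /squeeze min_l// le_max /rescale; apply/orP; right.
have k1 : 1 <= (r - m) / (r - 1) by rewrite ler_pdivlMr// mul1r lerD2l lerN2.
have : 0 <= ((r - m) / (r - 1) - 1) * (t - r).
  by rewrite mulr_ge0 ?subr_ge0.
by rewrite mulrBl mul1r; lra.
Qed.

Lemma squeeze_unit t : 0 <= l -> 0 <= t <= 1 -> 0 <= squeeze m t <= m.
Proof.
move=> l0 /andP[t0 t1]; apply/andP; split.
  have [tl|lt] := leP t l; first by rewrite squeeze_left.
  rewrite le_min t0 le_max; apply/orP; left; rewrite /rescale addr_ge0//.
  by rewrite mulr_ge0// ?subr_ge0 ?(ltW lt)// divr_ge0// ltW.
rewrite ge_min; apply/orP; right; rewrite ge_max /rescale; apply/andP; split.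
  rewrite -[leRHS](subrK l) addrC lerD2r mulrAC ler_pdivrMr//.
  by rewrite ler_wpM2l ?lerD2r// ltW.
have : r - m <= (r - m) / (r - 1) * (r - t).
  by rewrite mulrAC ler_pdivlMr// ler_wpM2l ?lerD2l ?lerN2// ltW.
by rewrite -[t - r]opprB mulrN; lra.
Qed.

End Squeeze.

Lemma squeeze1 l r t : l < 1 -> 1 < r -> squeeze l r 1 t = t.
Proof.
move=> l1 r1; rewrite /squeeze !divff ?gt_eqF ?subr_gt0//.
by rewrite /rescale !mul1r ![_ + (t - _)]addrC !subrK maxxx minxx.
Qed.

Section Continuity.
Variable T : topologicalType.
Implicit Types f g : T -> R.

Lemma continuous_rescale o (k t : T -> R) :
  continuous k -> continuous t -> continuous (fun x => rescale o (k x) (t x)).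
Proof.
move=> ck ct x; apply: (@continuousD R R T (cst o) (fun x => k x * (t x - o))).
  exact: cst_continuous.
apply: (@continuousM R T k (fun x => t x - o)); first exact: ck.
by apply: (@continuousB R R T t (cst o)); [exact: ct|exact: cst_continuous].
Qed.

Lemma continuous_div f g : continuous f -> continuous g ->
  (forall x, g x != 0) -> continuous (fun x => f x / g x).
Proof.
move=> cf cg g0 x; apply: (@continuousM R T f (fun x => (g x)^-1)); first exact: cf.
by apply: (@continuousV R T g) => //; exact: cg.
Qed.

Lemma continuous_subl (c : R) f : continuous f -> continuous (fun x => c - f x).
Proof.
move=> cf x; apply: (@continuousB R R T (cst c) f); last exact: cf.
exact: cst_continuous.
Qed.

Lemma continuous_subr (c : R) f : continuous f -> continuous (fun x => f x - c).
Proof.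
move=> cf x; apply: (@continuousB R R T f (cst c)); first exact: cf.
exact: cst_continuous.
Qed.

Lemma continuous_squeeze l r (m t : T -> R) : l < 1 -> 1 < r ->
  continuous m -> continuous t -> continuous (fun x => squeeze l r (m x) (t x)).
Proof.
move=> l1 r1 cm ct x; apply: (@continuous_min R T t); first exact: ct.
apply: (@continuous_max R T (fun x => rescale l ((m x - l) / (1 - l)) (t x))
         (fun x => rescale r ((r - m x) / (r - 1)) (t x))).
  apply: continuous_rescale => //; apply: continuous_div.
  - exact: continuous_subr.
  - by move=> y; exact: cst_continuous.
  - by move=> _; rewrite subr_eq0 gt_eqF.
apply: continuous_rescale => //; apply: continuous_div.
- exact: continuous_subl.
- by move=> y; exact: cst_continuous.
- by move=> _; rewrite subr_eq0 gt_eqF.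
Qed.

Lemma continuous_unsqueeze l r (m t : T -> R) : 1 < r -> (forall x, l < m x <= 1) ->
  continuous m -> continuous t -> continuous (fun x => unsqueeze l r (m x) (t x)).
Proof.
move=> r1 hm cm ct x; apply: (@continuous_max R T t); first exact: ct.
apply: (@continuous_min R T (fun x => rescale l ((1 - l) / (m x - l)) (t x))
         (fun x => rescale r ((r - 1) / (r - m x)) (t x))).
  apply: continuous_rescale => //; apply: continuous_div.
  - by move=> y; exact: cst_continuous.
  - exact: continuous_subr.
  - by move=> y; have /andP[h _] := hm y; rewrite subr_eq0 gt_eqF.
apply: continuous_rescale => //; apply: continuous_div.
- by move=> y; exact: cst_continuous.
- exact: continuous_subl.
- by move=> y; have /andP[_ h] := hm y; rewrite subr_eq0 gt_eqF// (le_lt_trans h).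
Qed.

End Continuity.

(** Each point of the segment has its own margin from F; compactness makes the
    margin uniform. *)
Lemma tube (F : set R3) (a u : R3) (l : R) : closed F ->
  (forall t, l <= t <= 1 -> ~ F (a + t *: u)) ->
  exists2 c : R, 0 < c & forall t v, l <= t <= 1 -> `|v| < c -> ~ F (a + t *: u + v).
Proof.
move=> cF Fl; have /compact_near_coveringP cc := @segment_compact R l 1.
have /nbhs_ballP[c /= c0 cP] : \forall v \near (0 : R3),
    (`[l, 1]%classic : set R) `<=` (fun t => ~ F (a + t *: u + v)).
  apply: (cc R3 (nbhs (0 : R3)) (fun v t => ~ F (a + t *: u + v))) => t /=.
  rewrite in_itv /= => /Fl Ft.
  have : nbhs (a + t *: u + 0) (~` F).
    by apply: open_nbhs_nbhs; split; [exact: closed_openC | rewrite addr0].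
  have cont : continuous (fun z : R * R3 => a + z.1 *: u + z.2).
    move=> z; apply: (@continuousD R R3 (R * R3)%type (fun z : R * R3 => a + z.1 *: u) snd).
      apply: (@continuousD R R3 (R * R3)%type (cst a) (fun z : R * R3 => z.1 *: u)).
        exact: cst_continuous.
      apply: (@continuousZ R R3 (R * R3)%type fst (cst u)); last exact: cst_continuous.
      exact: cvg_fst.
    exact: cvg_snd.
  by move=> /(cont (t, 0)).
exists c => // t v ht vc; apply: cP; last by rewrite /= in_itv.
by rewrite -ball_normE /= sub0r normrN.
Qed.

(** A homeomorphism that pulls the segment from a to b back into its initial part
    of length ratio s, and is supported in a thin tube around the part of the
    segment away from a.  On each line parallel to b - a it is a [squeeze] whose
    parameter m tends to 1, giving the identity, at the boundary of the tube.
    The set F may contain a. *)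
Lemma push (F : set R3) (a b : R3) (s : R) : closed F -> a != b -> 0 < s <= 1 ->
  (forall t, 0 < t <= 1 -> ~ F (a + t *: (b - a))) ->
  exists h : R3 -> R3, [/\ homeomorphism h, forall x, F x -> h x = x &
    forall t, 0 <= t <= 1 -> exists2 t', 0 <= t' <= s &
      h (a + t *: (b - a)) = a + t' *: (b - a)].
Proof.
move=> cF ab /andP[s0 s1] Fab; set u := b - a in Fab *.
have [j uj] : exists j, u 0 j != 0.
  apply: contrapT => /forallNP u0; case/negP: ab; rewrite eq_sym -subr_eq0.
  by apply/eqP/rowP => j; rewrite [RHS]mxE; apply/eqP/negPn/negP/u0.
(* tau is an affine coordinate along u; w is the remaining part of x - a. *)
pose l := s / 2; have l0 : 0 < l by rewrite divr_gt0.
have ls : l < s by rewrite ltr_pdivrMr// ltr_pMr// ltr1n.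
have l1 : l < 1 by exact: lt_le_trans s1.
have [c c0 cF'] : exists2 c : R, 0 < c & forall t v, l <= t <= 1 -> `|v| < c -> ~ F (a + t *: u + v).
  by apply: tube => // t /andP[lt t1]; apply: Fab; rewrite t1 (lt_le_trans l0).
have u1 : 0 < 1 + `|u| by rewrite ltr_pwDl.
pose d := c / (2 * (1 + `|u|)).
have d0 : 0 < d by rewrite divr_gt0// mulr_gt0.
pose r := 1 + d; have r1 : 1 < r by rewrite ltrDl.
pose tau x : R := (x - a) 0 j / u 0 j.
pose w x : R3 := x - a - tau x *: u.
pose m x : R := Num.min (s + (1 - s) / d * `|w x|) 1.
have hm x : l < m x <= 1.
  rewrite lt_min l1 ge_min lexx orbT !andbT (lt_le_trans ls)// lerDl.
  by rewrite mulr_ge0// divr_ge0 ?subr_ge0// ltW.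
have ctau : continuous tau.
  apply: continuous_div; last by move=> _.
    move=> x; apply: (@continuous_comp _ _ _ (fun x : R3 => x - a) (fun y : R3 => y 0 j)).
      by apply: (@continuousB R R3 R3 id (cst a)) => //; exact: cst_continuous.
    exact: coord_continuous.
  by move=> x; exact: cst_continuous.
have cw : continuous w.
  move=> x; apply: (@continuousB R R3 R3 (fun x => x - a) (fun x => tau x *: u)).
    by apply: (@continuousB R R3 R3 id (cst a)) => //; exact: cst_continuous.
  by apply: (@continuousZ R R3 R3 tau (cst u)); [exact: ctau | exact: cst_continuous].
have cm : continuous m.
  move=> x; apply: (@continuous_min R R3 (fun x => s + (1 - s) / d * `|w x|) (cst 1)).
    apply: (@continuousD R R R3 (cst s) (fun x => (1 - s) / d * `|w x|)).
      exact: cst_continuous.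
    apply: (@continuousM R R3 (cst ((1 - s) / d)) (fun x => `|w x|)).
      exact: cst_continuous.
    by apply: (@continuous_comp _ _ _ w (fun y : R3 => `|y|)); [exact: cw | exact: norm_continuous].
  exact: cst_continuous.
pose mv (t : R3 -> R) x : R3 := x + (t x - tau x) *: u.
have tau_mv t x : tau (mv t x) = t x.
  rewrite /tau /mv; set k := t x - _.
  have -> : (x + k *: u - a) 0 j = (x - a) 0 j + k * u 0 j by rewrite !mxE; ring.
  by rewrite mulrDl mulfK// -/(tau x) /k addrC subrK.
have w_mv t x : w (mv t x) = w x.
  by rewrite /w tau_mv /mv; apply/rowP => i; rewrite !mxE; ring.
have m_mv t x : m (mv t x) = m x by rewrite /m w_mv.
have cmv t : continuous t -> continuous (mv t).
  move=> ct x; apply: (@continuousD R R3 R3 id (fun x => (t x - tau x) *: u)) => //.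
  apply: (@continuousZ R R3 R3 (fun x => t x - tau x) (cst u)); last exact: cst_continuous.
  by apply: (@continuousB R R R3 t tau); [exact: ct | exact: ctau].
pose h := mv (fun x => squeeze l r (m x) (tau x)).
pose k := mv (fun x => unsqueeze l r (m x) (tau x)).
have inv t t' x : t' (mv t x) = tau x -> mv t' (mv t x) = x.
  move=> tt; rewrite {1}/mv tt tau_mv /mv.
  by apply/rowP => i; rewrite !mxE; ring.
exists h; split.
- split; first by apply: cmv; apply: continuous_squeeze.
  exists k; split; first by apply: cmv; apply: continuous_unsqueeze.
    move=> x; apply: inv; rewrite tau_mv m_mv.
    by have /andP[? ?] := hm x; exact: squeezeK.
  move=> x; apply: inv; rewrite tau_mv m_mv.
  by have /andP[? ?] := hm x; exact: unsqueezeK.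
- move=> x Fx; rewrite /h /mv (_ : squeeze _ _ _ _ = tau x) ?subrr ?scale0r ?addr0//.
  have /andP[lm m1] := hm x.
  have [tl|lt] := leP (tau x) l; first by rewrite squeeze_left.
  have [rt|tr] := leP r (tau x); first by rewrite squeeze_right.
  have [dw|wd] := leP d `|w x|.
    rewrite /m min_r ?squeeze1// -[leLHS](subrK s) addrC lerD2l mulrAC ler_pdivlMr//.
    by rewrite ler_wpM2l// subr_ge0.
  (* x is close to the point of the segment with parameter t. *)
  exfalso; pose t := Num.min (tau x) 1.
  apply: (cF' t (w x + (tau x - t) *: u)).
  + by rewrite le_min (ltW lt) (ltW l1) ge_min lexx orbT.
  + apply: (le_lt_trans (ler_normD _ _)); rewrite normrZ.
    have td : `|tau x - t| <= d.
      rewrite /t; have [t1|t1] := leP (tau x) 1; first by rewrite subrr normr0 ltW.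
      by rewrite ger0_norm ?subr_ge0 ltW// ltrBlDl.
    have : `|w x| + `|tau x - t| * `|u| <= d * (1 + `|u|).
      by rewrite mulrDr mulr1 lerD ?(ltW wd)// ler_wpM2r.
    move/le_lt_trans; apply; rewrite /d.
    rewrite (_ : c / _ * _ = c / 2); last by field; rewrite gt_eqF.
    by rewrite ltr_pdivrMr// ltr_pMr// ltr1n.
  + rewrite (_ : _ + _ = x)//; rewrite /w.
    by apply/rowP => i; rewrite !mxE; ring.
- move=> t ht; set x := a + t *: u.
  have tx : tau x = t.
    by rewrite /tau /x (_ : (_ - a) 0 j = t * u 0 j) ?mulfK// !mxE; ring.
  have mx : m x = s.
    have -> : m x = Num.min (s + (1 - s) / d * `|w x|) 1 by [].
    have -> : w x = 0 by rewrite /w tx /x; apply/rowP => i; rewrite !mxE; ring.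
    by rewrite normr0 mulr0 addr0 min_l.
  exists (squeeze l r s t); first by apply: squeeze_unit => //; exact: ltW.
  by rewrite /h /mv tx mx /x -addrA -scalerDl [t + _]addrC subrK.
Qed.

End Push.

(** * A sphere around an edge *)

Section EdgeSphere.
Variable R : realType.
Local Notation R3 := 'rV[R]_3.

Lemma closed_curve_image (g : R -> R3) (a b : R) :
  {within `[a, b], continuous g} -> closed (g @` `[a, b]).
Proof.
move=> cg; apply: compact_closed; first exact: norm_hausdorff.
by apply: continuous_compact => //; exact: segment_compact.
Qed.

(** The last segment is pulled back into a neighbourhood of its start that the
    homeomorphism obtained for the shorter arc already sends into the ball; both
    K and the shorter arc stay fixed, and by injectivity the shorter arc meets
    the last segment only in its start, as [push] demands. *)
Lemma arc_contracts (g : R -> R3) (K : set R3) (r : R) :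
  {within `[0, 1], continuous g} -> polygonal g ->
  (forall s t, 0 <= s <= 1 -> 0 <= t <= 1 -> g s = g t -> s = t) ->
  closed K -> (forall t, 0 <= t <= 1 -> ~ K (g t)) -> 0 < r ->
  exists h : R3 -> R3, [/\ homeomorphism h, forall x, K x -> h x = x &
    forall t, 0 <= t <= 1 -> ball (g 0) r (h (g t))].
Proof.
move=> cg [N [t [t0 tN tg]]] gI cK gK r0.
have tpos i : (i <= N)%N -> 0 <= t i.
  elim: i => [|i IH] iN; first by rewrite t0.
  by apply: le_trans (IH (ltnW iN)) _; rewrite ltW//; case: (tg i iN).
have tmono i k : (i + k <= N)%N -> t i <= t (i + k)%N.
  elim: k => [|k IH]; first by rewrite addn0.
  rewrite addnS => ikN; apply: le_trans (IH (ltnW ikN)) _.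
  by rewrite ltW//; case: (tg _ ikN).
have tle1 i : (i <= N)%N -> t i <= 1.
  by move=> iN; rewrite -tN -(subnKC iN); apply: tmono; rewrite subnKC.
suff key i : (i <= N)%N -> exists h : R3 -> R3,
    [/\ homeomorphism h, forall x, K x -> h x = x &
      forall s, 0 <= s <= t i -> ball (g 0) r (h (g s))].
  by have := key N (leqnn N); rewrite tN.
elim: i => [|i IH] iN.
  exists id; split => //; first by split; [move=> x|exists id; split => // x].
  move=> s; rewrite t0 => /andP[s0 s1].
  have -> : s = 0 by apply/eqP; rewrite eq_le s0 s1.
  exact: ballxx.
have [h [hh hK hb]] := IH (ltnW iN).
have [ti gi] := tg i iN.
set a := g (t i) in gi; set b := g (t i.+1) in gi.
have ti0 := tpos _ (ltnW iN); have ti1 := tle1 _ iN.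
have ti0' := tpos _ iN; have ti1' := tle1 _ (ltnW iN).
have ab : a != b.
  apply/eqP => /gI; rewrite ti0 ti1' ti0' ti1 => /(_ isT isT) tt.
  by move: ti; rewrite tt ltxx.
have u0 : b - a != 0 by rewrite subr_eq0 eq_sym.
have lineE (s : R) : (1 - s) *: a + s *: b = a + s *: (b - a).
  by apply/rowP => j; rewrite !mxE; ring.
have ch := hh.1.
have [s [s0 s1] hs] : exists2 s : R, 0 < s /\ s <= 1 & forall t', 0 <= t' <= s ->
    ball (g 0) r (h (a + t' *: (b - a))).
  have cl : {for (0 : R), continuous (fun t' : R => h (a + t' *: (b - a)))}.
    apply: (@continuous_comp _ _ _ (fun t' : R => a + t' *: (b - a)) h); last exact: ch.
    apply: (@continuousD R R3 R (cst a) (fun t' : R => t' *: (b - a))).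
      exact: cst_continuous.
    by apply: (@continuousZ R R3 R id (cst (b - a))) => //; exact: cst_continuous.
  have : nbhs (h (a + (0 : R) *: (b - a))) (ball (g 0) r).
    apply: open_nbhs_nbhs; split; first exact: ball_open.
    by rewrite scale0r addr0; apply: hb; rewrite ti0 lexx.
  move=> /cl /nbhs_ballP[d /= d0 hd].
  exists (Num.min (d / 2) 1); first by rewrite lt_min divr_gt0// ltr01 ge_min lexx orbT.
  move=> t' /andP[t'0]; rewrite le_min => /andP[t'd _]; apply: hd.
  rewrite /ball /= sub0r normrN ger0_norm//; apply: le_lt_trans t'd _.
  by rewrite ltr_pdivrMr// ltr_pMr// ltr1n.
have [||||k [hk kF kab]] := @push R (K `|` g @` `[0, t i]) a b s.
- apply: closedU => //; apply: closed_curve_image.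
  apply: continuous_subspaceW cg => x /=; rewrite !in_itv /= => /andP[-> /=].
  by move/le_trans; apply.
- exact: ab.
- by rewrite s0.
- move=> v /andP[v0 v1].
  have [w hw wE] : (g @` `[t i, t i.+1]) (a + v *: (b - a)).
    by rewrite gi; exists v => //=; rewrite in_itv /= ltW.
  move: hw; rewrite /= in_itv /= => /andP[w0 w1]; rewrite -wE.
  have ww : 0 <= w <= 1 by rewrite (le_trans ti0 w0) (le_trans w1 ti1).
  case=> [|[w' hw' /gI]]; first exact: gK.
  move: hw'; rewrite /= in_itv /= => /andP[w'0 w'1].
  rewrite w'0 (le_trans w'1 ti1') => /(_ isT ww) w'w.
  have wti : w = t i by apply/eqP; rewrite eq_le w0 andbT -w'w.
  move: wE; rewrite wti -/a -{1}[a]addr0 => /addrI/esym/eqP.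
  by rewrite scaler_eq0 (negbTE u0) orbF gt_eqF.
exists (h \o k); split.
- exact: homeomorphism_comp.
- by move=> x Kx /=; rewrite kF ?hK//; left.
move=> x /andP[x0 x1] /=; have [xi|ix] := leP x (t i).
  rewrite kF; first by apply: hb; rewrite x0.
  by right; exists x; rewrite //= in_itv /= x0.
have [v hv vE] : line_segment a b (g x).
  by rewrite -gi; exists x; rewrite //= in_itv /= (ltW ix).
rewrite -vE lineE; have [|t' ht' ->] := kab v; last exact: hs.
by move: hv; rewrite /= in_itv.
Qed.

Section CurveMeet.
Variables (G : graph) (f : embedding R G).

Lemma unit_interval_cases (t : R) : 0 <= t <= 1 -> [\/ t = 0, t = 1 | 0 < t < 1].
Proof.
move=> /andP[]; rewrite le_eqVlt => /predU1P[<-|t0]; first by constructor 1.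
by rewrite le_eqVlt => /predU1P[->|t1]; [constructor 2|constructor 3; rewrite t0].
Qed.

Lemma curve_end e t : 0 <= t <= 1 ->
  0 < t < 1 \/ exists2 v, v = (ends e).1 \/ v = (ends e).2 & curve f e t = position f v.
Proof.
move=> /unit_interval_cases[->|->|]; [right|right|by left].
  by exists (ends e).1; [left|rewrite curve0].
by exists (ends e).2; [right|rewrite curve1].
Qed.

Lemma curve_meet e e' t t' : 0 <= t <= 1 -> 0 <= t' <= 1 ->
  curve f e t = curve f e' t' -> e = e' \/
  exists2 v, v = (ends e).1 \/ v = (ends e).2 & v = (ends e').1 \/ v = (ends e').2.
Proof.
move=> /(@curve_end e)[ht|[v ve ->]] /(@curve_end e')[ht'|[v' ve' ->]].
- by move=> /curve_inj[]//; left.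
- by move=> /curve_position.
- by move=> /esym/curve_position.
- by move=> /position_inj vv; right; exists v => //; rewrite vv.
Qed.

Lemma curve_inj_arc e t t' : (ends e).1 <> (ends e).2 ->
  0 <= t <= 1 -> 0 <= t' <= 1 -> curve f e t = curve f e t' -> t = t'.
Proof.
move=> ee /unit_interval_cases[->|->|ht] /unit_interval_cases[->|->|ht'];
  rewrite ?curve0 ?curve1 // => h.
- by have := position_inj h.
- by have := curve_position ht' (esym h).
- by have := esym (position_inj h).
- by have := curve_position ht' (esym h).
- by have := curve_position ht h.
- by have := curve_position ht h.
- by have [] := curve_inj ht ht' h.
Qed.

End CurveMeet.

Definition misses (S : set R3) (c : R -> R3) : Prop :=
  forall t, 0 <= t <= 1 -> ~ S (c t).

Definition vertex_disjoint (G : graph) (e e' : edge G) : Prop :=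
  forall v, v = (ends e).1 \/ v = (ends e).2 -> v <> (ends e').1 /\ v <> (ends e').2.

Definition engulfs (G : graph) (f : embedding R G) (e : edge G) (S : set R3) : Prop :=
  [/\ embedded_sphere S, misses S (curve f e) &
    forall e' t', vertex_disjoint e e' -> 0 <= t' <= 1 ->
      ~ S (curve f e' t') /\
      forall t, 0 <= t <= 1 ->
        ~ connected_component (~` S) (curve f e t) (curve f e' t')].

Definition sumsq (x : R3) : R := \sum_i x 0 i ^+ 2.

Lemma sumsq_continuous : continuous sumsq.
Proof.
apply: continuous_big => [|i _ x]; first exact: add_continuous.
apply: (@continuousM R R3 (fun y : R3 => y 0 i) (fun y : R3 => y 0 i));
  exact: coord_continuous.
Qed.

Lemma sumsqZ (k : R) x : sumsq (k *: x) = k ^+ 2 * sumsq x.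
Proof. by rewrite big_distrr; apply: eq_bigr => i _; rewrite mxE exprMn. Qed.

(** The norm is the maximum norm: three squares below r^2 / 4 have
    a sum below r^2. *)
Lemma sumsq_lt (x : R3) (r : R) : `|x| < r / 2 -> sumsq x < r ^+ 2.
Proof.
move=> xr; have r0 : 0 < r.
  by have := le_lt_trans (normr_ge0 x) xr; rewrite pmulr_lgt0 ?invr_gt0.
have xi i : x 0 i ^+ 2 <= (r / 2) ^+ 2.
  rewrite -real_normK ?num_real// lerXn2r ?nnegrE ?divr_ge0 ?(ltW r0)//.
  apply: le_trans (ltW xr); rewrite [leRHS]/Num.norm /= mx_normrE.
  by apply/bigmax_geP; right; exists (0, i).
apply: (@le_lt_trans _ _ (\sum_(i < 3) (r / 2) ^+ 2)); first exact: ler_sum.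
rewrite !big_ord_recr big_ord0 /= add0r.
by have : 0 < r ^+ 2 by [rewrite exprn_gt0]; lra.
Qed.

Lemma norm_le_sumsq (x : R3) (r : R) : 0 <= r -> sumsq x <= r ^+ 2 -> `|x| <= r.
Proof.
move=> r0 xr; rewrite [leLHS]/Num.norm /= mx_normrE.
apply/bigmax_leP; split=> // -[i j] _ /=; rewrite ord1.
have : `|x 0 j| ^+ 2 <= r ^+ 2.
  apply: le_trans xr; rewrite real_normK ?num_real//.
  rewrite /sumsq (bigD1 j)//= lerDl sumr_ge0// => k _; exact: sqr_ge0.
by rewrite ler_pXn2r// nnegrE.
Qed.

(** On a connected set that avoids the level c, the points below c form a
    subset that is both open and closed. *)
Lemma sphere_separates (N : R3 -> R) (c : R) x y : continuous N ->
  N x < c -> c < N y -> ~ connected_component (~` [set z | N z = c]) x y.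
Proof.
move=> cN xc yc [C [Cx Csub cC] Cy].
have : C `&` [set z | N z < c] = C.
  apply: cC; first by exists x.
    exists [set z | N z < c] => //.
    rewrite (_ : [set z | _] = N @^-1` [set` `]-oo, c[]).
      by apply: open_comp => [z _|]; [exact: cN | exact: interval_open].
    by apply/seteqP; split => z /=; rewrite in_itv.
  exists [set z | N z <= c].
    rewrite (_ : [set z | _] = N @^-1` [set` `]-oo, c]]).
      by apply: closed_comp => [z _|]; [exact: cN | exact: interval_closed].
    by apply/seteqP; split => z /=; rewrite in_itv.
  apply/seteqP; split=> z [Cz /= zc]; split=> //=; first exact: ltW.
  by rewrite lt_neqAle zc andbT; apply/eqP; exact: Csub.
move=> CE; have : (C `&` [set z | N z < c]) y by rewrite CE.
by case=> _ /= /(lt_trans yc); rewrite ltxx.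
Qed.

(** A homeomorphism H moves the edge into a small ball and agrees with the
    polygonal picture on all edges that are vertex-disjoint from it; the preimage
    under H of the boundary of a concentric ball is the sphere. *)
Lemma edge_sphere (G : graph) (f : embedding R G) (e : edge G) :
  (ends e).1 <> (ends e).2 -> exists S, engulfs f e S.
Proof.
move=> ee; have [h [hh hpoly]] := curve_tame f.
pose far := [set e' | vertex_disjoint e e'].
pose K := \bigcup_(e' in far) ((h \o curve f e') @` `[0, 1]).
have ch := hh.1; have [k [_ hK _]] := hh.2.
have cc e' : {within `[0, 1], continuous (h \o curve f e')}.
  by apply: within_continuous_comp; [move=> x _; exact: ch | exact: curve_cont].
have cK : closed K.
  by apply: closed_bigcup => [|e' _]; [exact: finite_finset | exact: closed_curve_image].
pose g := h \o curve f e.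
have gI s t : 0 <= s <= 1 -> 0 <= t <= 1 -> g s = g t -> s = t.
  by move=> hs ht /(can_inj hK); exact: curve_inj_arc.
have gK t : 0 <= t <= 1 -> ~ K (g t).
  move=> ht [e' fe' [t' ht' /(can_inj hK)]].
  have {}ht' : 0 <= t' <= 1 by move: ht'; rewrite /= in_itv.
  move=> /esym /(curve_meet ht ht')[ee'|[v ve ve']].
    by have [] := fe' (ends e).1 (or_introl erefl); rewrite ee'.
  by have [n1 n2] := fe' v ve; case: ve'.
have h0 : 0 <= (0 : R) <= 1.
  by rewrite lexx ler01.
have [r r0 rK] : exists2 r : R, 0 < r & ball (g 0) r `<=` ~` K.
  have : nbhs (g 0) (~` K).
    by apply: open_nbhs_nbhs; split; [exact: closed_openC | exact: gK].
  by move=> /nbhs_ballP[r r0 rK]; exists r.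
have r2 : 0 < r / 2 by rewrite divr_gt0.
have r4 : 0 < r / 2 / 2 by rewrite divr_gt0.
have [h' [hh' h'K h'g]] := arc_contracts (cc e) (hpoly e) gI cK gK r4.
have [cH [k' [ck' HK kH]]] := homeomorphism_comp hh' hh.
pose H := h' \o h; pose N x := sumsq (H x - g 0).
have cN : continuous N.
  move=> x; apply: (@continuous_comp _ _ _ (fun x => H x - g 0) sumsq).
    by apply: (@continuousB R R3 R3 H (cst (g 0))); [exact: cH | exact: cst_continuous].
  exact: sumsq_continuous.
have Nin t : 0 <= t <= 1 -> N (curve f e t) < (r / 2) ^+ 2.
  by move=> ht; apply: sumsq_lt; rewrite distrC; have := h'g t ht; rewrite -ball_normE.
have Nout e' t' : far e' -> 0 <= t' <= 1 -> (r / 2) ^+ 2 < N (curve f e' t').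
  move=> fe' ht'; rewrite ltNge; apply/negP => /(norm_le_sumsq (ltW r2)).
  have Kt : K (h (curve f e' t')) by exists e' => //; exists t'; rewrite //= in_itv.
  rewrite /H /= h'K// => hr; apply: (rK _ _ Kt); rewrite -ball_normE /= distrC.
  by apply: le_lt_trans hr _; rewrite ltr_pdivrMr// ltr_pMr// ltr1n.
exists [set x | N x = (r / 2) ^+ 2]; split.
- exists (fun y => k' (g 0 + (r / 2) *: y)); split.
  + apply: continuous_subspaceT => y.
    apply: (@continuous_comp _ _ _ (fun y : R3 => g 0 + (r / 2) *: y) k'); last exact: ck'.
    apply: (@continuousD R R3 R3 (cst (g 0)) (fun y : R3 => (r / 2) *: y)).
      exact: cst_continuous.
    by apply: (@continuousZ R R3 R3 (cst (r / 2)) id) => //; exact: cst_continuous.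
  + move=> x y _ _ /(can_inj kH)/addrI; apply: scalerI; exact: lt0r_neq0.
  + apply/seteqP; split=> x /=.
      move=> Nx; exists ((r / 2)^-1 *: (H x - g 0)).
        rewrite /unit_sphere /= -/(sumsq _) sumsqZ -/(N x) Nx exprVn mulVf//.
        by rewrite expf_neq0// lt0r_neq0.
      rewrite scalerA divff ?lt0r_neq0// scale1r addrC subrK; exact: HK.
    move=> [y uy <-]; rewrite /N (_ : H _ = g 0 + (r / 2) *: y); last exact: kH.
    by rewrite addrAC subrr add0r sumsqZ [sumsq y]uy mulr1.
- by move=> t /Nin + /= eq; rewrite eq ltxx.
- move=> e' t' fe' ht'; split.
    by have := Nout e' t' fe' ht' => + /= eq; rewrite eq ltxx.
  by move=> t ht; apply: sphere_separates => //; [exact: Nin | exact: Nout].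
Qed.

End EdgeSphere.

(** * Counting non-split links *)

Section Main.
Variable R : realType.
Local Notation R3 := 'rV[R]_3.

Lemma embedded_sphere_closed (S : set R3) : embedded_sphere S -> closed S.
Proof.
move=> [phi [cphi _ ->]]; apply: compact_closed; first exact: norm_hausdorff.
apply: continuous_compact => //; apply: bounded_closed_compact.
  exists 1; split; first exact: num_real.
  move=> M M1 x ux; apply: (le_trans _ (ltW M1)); apply: norm_le_sumsq => //.
  by rewrite expr1n [sumsq x]ux.
rewrite (_ : @unit_sphere R = @sumsq R @^-1` [set 1])//.
by apply: closed_comp; [move=> x _; exact: sumsq_continuous | exact: closed_eq].
Qed.

Section Doubled.
Variables (G : graph) (f : embedding R G).
Local Notation UG := (underlying (symmetric_digraph G)).
Variable g : embedding R UG.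
Hypothesis gf : forall e, curve g (e, false) = curve f e.
Implicit Types (S : set R3) (L : {set {set darc (symmetric_digraph G)}}).

(** A backward arc that misses S is connected, off S, to the curve of its edge,
    since they have the same ends. *)
Lemma parallel_component S e b t :
  misses S (curve f e) -> misses S (curve g (e, true)) -> 0 <= t <= 1 ->
  exists2 t', 0 <= t' <= 1 &
    connected_component (~` S) (curve g (e, b) t) (curve f e t').
Proof.
move=> Sf Sg ht; case: b; last first.
  by exists t => //; rewrite gf; apply: connected_component_refl; exact: Sf.
have h0 : 0 <= (0 : R) <= 1 by rewrite lexx ler01.
have h1 : 0 <= (1 : R) <= 1 by rewrite lexx ler01.
exists 1 => //; have -> : curve f e 1 = curve g (e, true) 0.
  by rewrite curve0 -gf curve1.
exists (curve g (e, true) @` `[0, 1]).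
  split.
  - by exists t; rewrite //= in_itv.
  - by move=> _ [s hs <-]; apply: Sg; move: hs; rewrite /= in_itv.
  - apply: connected_continuous_connected; first exact: segment_connected.
    exact: curve_cont.
by exists 0; rewrite //= in_itv.
Qed.

Lemma image_avoids S (C : {set edge UG}) :
  (forall e b, ((e, b) : edge UG) \in C -> misses S (curve f e)) ->
  (forall e, misses S (curve f e) -> misses S (curve g (e, true))) ->
  S `&` image_of g C = set0.
Proof.
move=> SC Sg; apply/seteqP; split=> // x [Sx [[e b] [t [eC ht xE]]]].
have Se : misses S (curve f e) by exact: SC eC.
move: Sx; rewrite xE; case: b {eC xE} => //; first exact: Sg.
by rewrite gf; exact: Se.
Qed.

(** The components of L lie on the same sides of S as their projections. *)
Lemma split_by_forget S L : liftable L -> embedded_sphere S ->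
  (forall e, misses S (curve f e) -> misses S (curve g (e, true))) ->
  split_by f (forget_link L) S -> split_by g L S.
Proof.
move=> lL eS Sg [SL [A [A0 AL sep]]].
have SC C : C \in L -> forall e b, ((e, b) : edge UG) \in C -> misses S (curve f e).
  move=> CL e b eC t ht St.
  have /SL : forget C \in forget_link L by apply/imsetP; exists C.
  move=> /seteqP[/(_ (curve f e t)) h _]; apply: h; split => //.
  by exists e, t; split=> //; exact: (mem_forget eC).
split; first by move=> C CL; apply: image_avoids => //; exact: SC.
exists [set C in L | forget C \in A]%SET.
have [/fintype.subsetP AL' [M ML MA]] := properP AL.
split.
- have /set0Pn[M' M'A] := A0; have /imsetP[C CL CE] := AL' _ M'A.
  by apply/set0Pn; exists C; rewrite inE CL -CE.
- apply/properP; split; first by apply/fintype.subsetP => C; rewrite inE => /andP[].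
  have /imsetP[C CL CE] := ML; exists C => //.
  by rewrite inE CL -CE (negbTE MA).
move=> C C' x y; rewrite !inE => /andP[CL CA] /andP[nC' C'L].
rewrite C'L /= in nC'.
move=> [[e b] [t [eC ht ->]]] [[e' b'] [t' [eC' ht' ->]]] xy.
have Se : misses S (curve f e) by exact: (SC C CL e b).
have Se' : misses S (curve f e') by exact: (SC C' C'L e' b').
have [s hs ts] := parallel_component b Se (Sg _ Se) ht.
have [s' hs' ts'] := parallel_component b' Se' (Sg _ Se') ht'.
apply: (sep (forget C) (forget C') (curve f e s) (curve f e' s') CA).
- by rewrite finset.in_setD nC'; apply/imsetP; exists C'.
- by exists e, s; split => //; exact: (mem_forget eC).
- by exists e', s'; split => //; exact: (mem_forget eC').
apply: connected_component_trans (connected_component_sym ts) _.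
exact: connected_component_trans xy ts'.
Qed.

(** The component C consists of the two arcs over e, and the other components
    have no vertex in common with e, so S splits off C. *)
Lemma double_edge_split S L C e :
  is_link (G := UG) L -> (2 <= #|L|)%N -> C \in L -> consistently_oriented C ->
  ((e, false) : edge UG) \in C -> ((e, true) : edge UG) \in C ->
  engulfs f e S ->
  (forall e, misses S (curve f e) -> misses S (curve g (e, true))) ->
  split_by g L S.
Proof.
move=> lL L2 CL oC eC eC' [_ Se Sfar] Sg.
have [_ CE] := oriented_double oC eC eC'.
have inC e' b : ((e', b) : edge UG) \in C -> e' = e.
  by rewrite CE !inE => /orP[]/eqP[].
have far C' e' b : C' \in L -> C' != C -> ((e', b) : edge UG) \in C' ->
    vertex_disjoint e e'.
  move=> C'L CC' e'C' v ve.
  have vC : v \in vertices_of (G := UG) C.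
    rewrite vertices_of_forget inE; apply/existsP; exists e.
    by rewrite (mem_forget eC) /=; case: ve => ->; rewrite eqxx ?orbT.
  have vC' : v \notin vertices_of (G := UG) C'.
    by apply: contra_neqN CC' => vC'; exact: (link_vertex_eq lL C'L CL vC' vC).
  move: vC'; rewrite vertices_of_forget inE => /existsPn/(_ e').
  by rewrite (mem_forget e'C') /= negb_or => /andP[/eqP ? /eqP ?].
have SC C' e' b : C' \in L -> ((e', b) : edge UG) \in C' ->
    misses S (curve f e').
  move=> C'L e'C' t ht; have [CC'|CC'] := eqVneq C' C.
    by rewrite (inC e' b) -?CC'//; exact: Se.
  by case: (Sfar e' t (far C' e' b C'L CC' e'C') ht).
split.
  by move=> C' C'L; apply: image_avoids => // e' b h; exact: (SC C' e' b).
exists [set C]%SET; split.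
- by apply/set0Pn; exists C; rewrite inE.
- by rewrite properEcard finset.sub1set CL cards1.
move=> C1 C' x y; rewrite inE => /eqP ->; rewrite !inE => /andP[CC' C'L].
move=> [[e1 b] [t [e1C ht ->]]] [[e' b'] [t' [eC1' ht' ->]]] xy.
move: e1C xy => /[dup] /inC -> e1C xy.
have Se' : misses S (curve f e') by exact: (SC C' e' b').
have [s hs ts] := parallel_component b Se (Sg _ Se) ht.
have [s' hs' ts'] := parallel_component b' Se' (Sg _ Se') ht'.
have [_ /(_ s hs)] := Sfar e' s' (far C' e' b' C'L CC' eC1') hs'.
apply; apply: connected_component_trans (connected_component_sym ts) _.
exact: connected_component_trans xy ts'.
Qed.

End Doubled.

Definition oriented_link (G : graph)
    (g : embedding R (underlying (symmetric_digraph G)))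
    (L : {set {set darc (symmetric_digraph G)}}) : Prop :=
  [/\ (2 <= #|L|)%N, is_link (G := underlying (symmetric_digraph G)) L,
      non_split g L & forall C, C \in L -> consistently_oriented C].

(** The test spheres are indexed by the sets of edge sets, of which only the split
    links matter, and by the edges, of which only the non-loops do; the empty set
    stands in elsewhere. *)
Lemma parallel_embedding (G : graph) (f : embedding R G) :
  exists g : embedding R (underlying (symmetric_digraph G)),
  forall L, oriented_link g L -> liftable L /\ non_split f (forget_link L).
Proof.
have /choice[T TP] (L : {set {set edge G}}) : exists S, closed S /\
    ((exists S, embedded_sphere S /\ split_by f L S) ->
     embedded_sphere S /\ split_by f L S).
  have [[S [eS sS]]|nS] := pselect (exists S, embedded_sphere S /\ split_by f L S).
    by exists S; split => //; exact: embedded_sphere_closed.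
  by exists set0; split => //; exact: closed0.
have /choice[T' TP'] (e : edge G) : exists S, closed S /\
    ((ends e).1 <> (ends e).2 -> engulfs f e S).
  have [ee|ee] := pselect ((ends e).1 <> (ends e).2).
    have [S eS] := edge_sphere f ee; exists S; split => //.
    by have [? _ _] := eS; exact: embedded_sphere_closed.
  by exists set0; split => //; exact: closed0.
pose Z (i : {set {set edge G}} + edge G) := match i with inl L => T L | inr e => T' e end.
have cZ i : closed (Z i) by case: i => [L|e]; [case: (TP L)|case: (TP' e)].
have [g [gf gZ]] := doubled_embedding f cZ.
exists g => L [L2 lL nL oL].
have sL C : C \in L -> simple C.
  move=> CL e [eC eC']; apply: nL; exists (T' e).
  have [ee _] := oriented_double (oL C CL) eC eC'.
  have [_ /(_ ee) eS] := TP' e; split; first by case: eS.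
  by apply: (double_edge_split gf lL L2 CL (oL C CL) eC eC' eS) => e'; exact: (gZ e' (inr e)).
have lfL : liftable L by split=> // C CL; split; [exact: oL|exact: sL].
split=> // sf; have [_ /(_ sf)[eS sS]] := TP (forget_link L).
apply: nL; exists (T (forget_link L)); split => //.
by apply: (split_by_forget gf lfL eS _ sS) => e; exact: (gZ e (inl (forget_link L))).
Qed.

Lemma minimum_le (A : set nat) m : A m -> (minimum A <= m)%N.
Proof.
move=> Am; rewrite /minimum.
have exA : exists k, `[< A k >] by exists m; apply/asboolP.
pose least := [set k | A k /\ forall m, A m -> (k <= m)%N].
have : least (xget 0%N least).
  apply: xgetPex; case: (ex_minnP exA) => k /asboolP Ak kmin; exists k; split => //.
  by move=> j Aj; apply: kmin; apply/asboolP.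
by case=> _; apply.
Qed.

Definition non_split_links (G : graph) (f : embedding R G) : {set {set {set edge G}}} :=
  [set M : {set {set edge G}} | `[< [/\ (2 <= #|M|)%N, is_link M & non_split f M] >]]%SET.

(** Both sides count the non-split links of f with weight 2^n; links with more
    components than there are sets of edges do not exist. *)
Lemma sum_by_card (G : graph) (f : embedding R G) :
  (\sum_(M in non_split_links f) 2 ^ #|M| =
   \big[addn/0]_(n \in [set n : nat | (2 <= n)%N]) (num_links f n * 2 ^ n))%N.
Proof.
pose B := #|{set edge G}|.
have cB (M : {set {set edge G}}) : (#|M| < B.+1)%N by rewrite ltnS max_card.
rewrite -(@bigfs _ _ _ _ (iota 0 B.+1) (leq 2)) ?iota_uniq//; last first.
  move=> n _; rewrite mem_iota /= add0n -leqNgt => Bn.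
  rewrite /num_links (_ : [set L | _]%SET = finset.set0) ?cards0//.
  apply/setP => L; rewrite !inE; apply/asboolP => -[Ln _ _].
  by have := cB L; rewrite Ln ltnNge Bn.
rewrite -[iota 0 _]/(index_iota 0 B.+1) big_mkord.
rewrite (partition_big (fun M : {set {set edge G}} => Ordinal (cB M)) (fun n : 'I_B.+1 => (2 <= n)%N)) /=.
  apply: eq_bigr => n n2; rewrite /num_links -sum1_card big_distrl /=.
  rewrite [LHS](eq_bigl (fun M => M \in [set L : {set {set edge G}} |
      `[< [/\ #|L| = n, is_link L & non_split f L] >]]%SET)).
    by apply: eq_bigr => M; rewrite inE mul1n => /asboolP[-> _ _].
  move=> M; rewrite !inE; apply/andP/asboolP.
    by move=> [/asboolP[_ lM nM] /eqP <-].
  move=> [Mn lM nM]; split; last by apply/eqP/val_inj.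
  by apply/asboolP; split=> //; rewrite Mn.
by move=> M; rewrite inE => /asboolP[].
Qed.

Lemma oriented_links_le (G : graph) (f : embedding R G)
    (g : embedding R (underlying (symmetric_digraph G))) :
  (forall L, oriented_link g L -> liftable L /\ non_split f (forget_link L)) ->
  (num_oriented_links g <= \sum_(M in non_split_links f) 2 ^ #|M|)%N.
Proof.
move=> gP; rewrite /num_oriented_links; set OL := [set L | _]%SET.
have OLP L : L \in OL -> liftable L /\ forget_link L \in non_split_links f.
  rewrite inE => /asboolP[L2 lL nL oL]; have [fL nfL] := gP L (And4 L2 lL nL oL).
  split=> //; rewrite inE; apply/asboolP; split => //.
    by rewrite card_forget_link.
  exact: forget_is_link.
rewrite -sum1_card (partition_big (@forget_link G) (mem (non_split_links f))) /=; last first.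
  by move=> L /OLP[].
apply: leq_sum => M _; rewrite sum1dep_card.
by apply: card_lifts => L; rewrite inE => /andP[/OLP[lL _] /eqP].
Qed.

End Main.

Local Close Scope ring_scope.

(* The sum over all n >= 2 is finitely supported: n disjoint cycles require at
   least n vertices. *)
Theorem corollary7p4 (R : realType) (G : graph)
  (hG : exists f : embedding R G, forall n : nat, (2 <= n)%N -> realizes_mnl f n) :
  (mnl_oriented R (symmetric_digraph G) <=
   \big[addn/0]_(n \in [set n : nat | (2 <= n)%N]) (mnl R G n * 2 ^ n))%N.
Proof.
have [f fmin] := hG; have [g gP] := parallel_embedding f.
rewrite (eq_fsbigr (fun n => num_links f n * 2 ^ n)%N); last first.
  by move=> n; rewrite inE /= => n2; rewrite -(fmin n n2).
rewrite -sum_by_card; apply: leq_trans (oriented_links_le gP).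
by apply: minimum_le; exists g.
Qed.
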